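(* Let $k\ge 2$, let $R=\mathbb{C}[x,y]/(x^k)$ be $\mathbb{Z}$-graded with $\deg x=1$, $\deg y=-1$, and let $\mathcal{C}=\mathrm{MCM}_{\mathbb{Z}}R$. Given two $k$-subsets $\underline{\ell},\underline{m}$ of $\mathbb{Z}$, with corresponding generically free modules of rank $1$ $I(\underline{\ell})$ and $I(\underline{m})$ in $\mathcal{C}$, $$\dim_{\mathbb{C}}\mathrm{Ext}^1_{\mathcal{C}}(I(\underline{\ell}),I(\underline{m}))=\alpha(\underline{\ell},\underline{m})+\beta(\underline{\ell},\underline{m})-k-|\underline{\ell}\cap\underline{m}|.$$
   Context: Gradings: for a graded module $M$, $M(j)$ is the shift $M(j)_i=M_{i+j}$; morphisms of graded modules are homogeneous of degree $0$. $\mathrm{gr}R$ is the category of finitely generated $\mathbb{Z}$-graded $R$-modules. $\mathrm{MCM}_{\mathbb{Z}}R$ is the full subcategory of $\mathrm{gr}R$ of maximal Cohen--Macaulay modules, i.e. those $M$ with $\mathrm{Ext}^i_R(M,R)=0$ for all $i>0$ (equivalently, since $R$ is Gorenstein, $\mathrm{depth}(M_{\mathfrak p})=\dim R_{\mathfrak p}$ for all primes $\mathfrak p$ in the support of $M$). $\mathrm{Ext}^1_{\mathcal{C}}$ is the extension space in the exact category $\mathcal{C}$, i.e. $\mathrm{Ext}^1$ in $\mathrm{gr}R$ (the degree $0$ part of $\mathrm{Ext}^1_R$). A $k$-subset of $\mathbb{Z}$ is a subset with $k$ elements, viewed as a strictly increasing tuple $\underline{\ell}=(\ell_1<\dots<\ell_k)$.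 To $\underline{\ell}$ one associates the (shifted) graded ideal $$I(\underline{\ell})=(x^{k-1},x^{k-2}y^{i_1},\dots,xy^{i_{k-2}},y^{i_{k-1}})(i_k),\quad i_k=k-1-\ell_k,\ \ i_{k-p}=\ell_k-\ell_p-(k-p)\ (1\le p\le k-1).$$ These are, up to isomorphism, exactly the generically free modules of rank $1$ in $\mathcal{C}$ (those $M$ such that $M\otimes_R R_y$ is graded free of rank $1$ over $R_y=\mathbb{C}[x,y^{\pm1}]/(x^k)$). For $1\le p\le k$ let $D_p^+=\{(i,j)\in\{1,\dots,k\}^2\mid j-i=k-p\}$ and $D_p^-=\{(i,j)\in\{1,\dots,k\}^2\mid i-j=k-p\}$. Define $$\alpha(\underline{\ell},\underline{m})=\max\{1\le p\le k\mid \ell_i\le m_j\ \text{for all }(i,j)\in D_p^+\},$$ $$\beta(\underline{\ell},\underline{m})=\max\{1\le p\le k\mid \ell_i\ge m_j\ \text{for all }(i,j)\in D_p^-\},$$ each taken to be $0$ if no such $p$ exists. *)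

(* Defs.v *)
From HB Require Import structures.
From mathcomp Require Import all_boot all_order all_algebra finmap.
From mathcomp Require Import boolp reals.
From mathcomp Require Import ring.
From mathcomp.real_closed Require Export complex.
Set Implicit Arguments.
Unset Strict Implicit.
Unset Printing Implicit Defensive.
Import Order.TTheory GRing.Theory Num.Theory.
Local Open Scope ring_scope.

Section TruncatedRing.
Variables (F : fieldType) (k : nat).

(* F[x,y]/(x^k) = F[y][x]/(x^k).  The library quotient is the intended one
   only for k >= 1: for k = 0 it silently becomes F[y][x]/(x). *)
Definition truncR := {poly %/ ('X^k : {poly {poly F}})}.

Definition cstR (c : F) : truncR := qpolyC 'X^k c%:P.
Definition xR : truncR := in_qpoly 'X^k 'X.
Definition yR : truncR := qpolyC 'X^k 'X.

(* The coefficient of x^a y^b in the canonical representative of r. *)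
Definition coefxy (r : truncR) (a b : nat) : F := ((r : {poly {poly F}})`_a)`_b.

(* The grading with deg x = 1 and deg y = -1. *)
Definition degR (n : int) (r : truncR) : Prop :=
  forall a b : nat, coefxy r a b != 0 -> a%:Z - b%:Z = n.

Lemma coef_rmodXk (p : {poly {poly F}}) a :
  (Pdiv.CommonRing.rmodp p (mk_monic 'X^k))`_a
    = if (a < k.-1.+1)%N then p`_a else 0.
Proof.
by rewrite mk_monic_Xn -Pdiv.RingMonic.take_poly_rmodp coef_take_poly.
Qed.

Lemma coefxyM (r s : truncR) a b : coefxy (r * s) a b =
  if (a < k.-1.+1)%N then
    \sum_(i < a.+1) \sum_(j < b.+1) coefxy r i j * coefxy s (a - i)%N (b - j)%N
  else 0.
Proof.
rewrite /coefxy poly_of_qpolyM coef_rmodXk; case: ifP => // _; last by rewrite coef0.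
rewrite coefM coef_sum; apply: eq_bigr => i _; exact: coefM.
Qed.

Lemma coefxyD r s a b : coefxy (r + s) a b = coefxy r a b + coefxy s a b.
Proof. by rewrite /coefxy /= !coefD. Qed.

Lemma coefxy0 a b : coefxy 0 a b = 0.
Proof. by rewrite /coefxy /= !coef0. Qed.

Lemma coefxy_inj r s : (forall a b, coefxy r a b = coefxy s a b) -> r = s.
Proof.
by move=> h; apply: val_inj; apply/polyP => a; apply/polyP => b; apply: h.
Qed.

Lemma coefxy_sum I (t : seq I) (f : I -> truncR) a b :
  coefxy (\sum_(i <- t) f i) a b = \sum_(i <- t) coefxy (f i) a b.
Proof.
apply: (big_morph (fun r => coefxy r a b)) => [r s|]; last exact: coefxy0.
exact: coefxyD.
Qed.

Lemma degR0 n : degR n 0.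
Proof. by move=> a b; rewrite coefxy0 eqxx. Qed.

Lemma degRD n r s : degR n r -> degR n s -> degR n (r + s).
Proof.
move=> hr hs a b; rewrite coefxyD.
have [r0|/hr//] := eqVneq (coefxy r a b) 0.
by rewrite r0 add0r => /hs.
Qed.

Lemma degRM m n r s : degR m r -> degR n s -> degR (m + n) (r * s).
Proof.
move=> hr hs a b; rewrite coefxyM; case: ifP => _; last by rewrite eqxx.
apply: contraNeq => ne.
rewrite big1 // => i _; rewrite big1 // => j _.
have [->|ri] := eqVneq (coefxy r i j) 0; first by rewrite mul0r.
have [->|si] := eqVneq (coefxy s (a - i)%N (b - j)%N) 0; first by rewrite mulr0.
case/eqP: ne; rewrite -(hr _ _ ri) -(hs _ _ si).
have := ltn_ord i; have := ltn_ord j; rewrite !ltnS => lej lei.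
rewrite -!subzn //; ring.
Qed.

Lemma qpolyC_in (c : {poly F}) : qpolyC 'X^k c = in_qpoly 'X^k c%:P.
Proof.
apply: val_inj; rewrite /= Pdiv.CommonRing.rmodp_small // size_polyC.
by rewrite (leq_ltn_trans _ (size_mk_monic_gt1 _)) //; case: eqP.
Qed.

Lemma in_qpolyXn (p : {poly {poly F}}) n :
  in_qpoly 'X^k (p ^+ n) = in_qpoly 'X^k p ^+ n :> truncR.
Proof.
elim: n => [|n IH]; first by rewrite !expr0 in_qpoly1.
by rewrite !exprS in_qpolyM IH.
Qed.

Lemma mono_xy (a b : nat) :
  xR ^+ a * yR ^+ b = in_qpoly 'X^k ('X^b *: 'X^a : {poly {poly F}}).
Proof.
rewrite -mul_polyC mulrC in_qpolyM in_qpolyXn.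
by rewrite (rmorphXn (@polyC {poly F})) in_qpolyXn -qpolyC_in.
Qed.

Lemma degR_mono (a b : nat) : degR (a%:Z - b%:Z) (xR ^+ a * yR ^+ b).
Proof.
move=> i j; rewrite mono_xy /coefxy /= coef_rmodXk.
case: ifP => _; last by rewrite coef0 eqxx.
rewrite coefZ coefXn; case: (eqVneq i a) => [->|_] /=; last first.
  by rewrite mulr0 coef0 eqxx.
by rewrite mulr1 coefXn; case: (eqVneq j b) => [->|_] //=; rewrite eqxx.
Qed.

Lemma degR_cst (c : F) : degR 0 (cstR c).
Proof.
move=> a b; rewrite /coefxy /= coefC; case: (eqVneq a 0%N) => [->|_]; last first.
  by rewrite coef0 eqxx.
by rewrite coefC; case: (eqVneq b 0%N) => [->|_] //; rewrite eqxx.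
Qed.

Lemma truncR_sum_mono (r : truncR) :
  r = \sum_(i < size (r : {poly {poly F}}))
        \sum_(j < size (r : {poly {poly F}})`_i)
          cstR (coefxy r i j) * (xR ^+ i * yR ^+ j).
Proof.
have E (c : F) i j : cstR c * (xR ^+ i * yR ^+ j)
    = in_qpoly 'X^k ((c *: 'X^j) *: 'X^i : {poly {poly F}}).
  rewrite mono_xy -[(c *: 'X^j)]mul_polyC -scalerA.
  rewrite [in RHS]in_qpolyZ -[in RHS](mul1r (in_qpoly _ _)) scalerAl.
  congr (_ * _); apply: val_inj => /=.
  by rewrite -mul_polyC mulr1.
rewrite {1}(_ : r = in_qpoly 'X^k (r : {poly {poly F}})); last first.
  by apply: val_inj; rewrite /= Pdiv.CommonRing.rmodp_small // size_mk_monic.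
rewrite -{1}[polyn r]coefK poly_def raddf_sum; apply: eq_bigr => i _.
rewrite -{1}[(polyn r)`_i]coefK poly_def scaler_suml raddf_sum.
by apply: eq_bigr => j _; rewrite E.
Qed.

Lemma degR_indep (s : seq int) (f : int -> truncR) :
  uniq s -> (forall i, i \in s -> degR i (f i)) -> \sum_(i <- s) f i = 0 ->
  forall i, i \in s -> f i = 0.
Proof.
move=> us hf s0 i si; apply: coefxy_inj => a b; rewrite coefxy0.
have [//|ne] := eqVneq (coefxy (f i) a b) 0.
have := congr1 (fun r => coefxy r a b) s0.
rewrite coefxy_sum coefxy0 (bigD1_seq i) //= big1_seq ?addr0 //.
move=> j /andP[nij sj]; apply/eqP; apply: contraNT nij => nj.
by rewrite -(hf _ sj _ _ nj) -(hf _ si _ _ ne).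
Qed.

End TruncatedRing.
Arguments xR {F k}.
Arguments yR {F k}.
Arguments cstR {F k} c.

Section GradedModules.
Variables (F : fieldType) (k : nat).
Local Notation R := (truncR F k).

(* gpart i is the homogeneous component of degree i; the last two fields say
   that the module is the internal direct sum of its components. *)
Record gmod := GMod {
  gsort :> lmodType R;
  gpart : int -> gsort -> Prop;
  gpart0 : forall i, gpart i 0;
  gpartD : forall i u v, gpart i u -> gpart i v -> gpart i (u + v);
  gpartZ : forall n i r u, degR n r -> gpart i u -> gpart (n + i) (r *: u);
  gpart_span : forall u : gsort, exists (n : nat) (d : nat -> int)
    (v : nat -> gsort), (forall i, gpart (d i) (v i)) /\ u = \sum_(i < n) v i;
  gpart_indep : forall (s : seq int) (v : int -> gsort),
    uniq s -> (forall i, i \in s -> gpart i (v i)) -> \sum_(i <- s) v i = 0 ->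
    forall i, i \in s -> v i = 0
}.

Definition homogeneous (M N : gmod) (f : M -> N) : Prop :=
  forall i u, gpart i u -> gpart i (f u).

Section Shift.
Variables (M : gmod) (j : int).

Lemma gshiftZ n i r (u : M) :
  degR n r -> gpart (i + j) u -> gpart (n + i + j) (r *: u).
Proof. by move=> hr hu; rewrite -addrA; apply: gpartZ. Qed.

Lemma gshift_span (u : M) : exists (n : nat) (d : nat -> int) (v : nat -> M),
  (forall i, gpart (d i + j) (v i)) /\ u = \sum_(i < n) v i.
Proof.
have [n [d [v [hv ->]]]] := gpart_span u.
by exists n, (fun i => d i - j), v; split=> // i; rewrite subrK.
Qed.

Lemma gshift_indep (s : seq int) (v : int -> M) :
  uniq s -> (forall i, i \in s -> gpart (i + j) (v i)) ->
  \sum_(i <- s) v i = 0 -> forall i, i \in s -> v i = 0.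
Proof.
move=> us hv s0 i si.
have := @gpart_indep M [seq i + j | i <- s] (fun n => v (n - j)).
rewrite (map_inj_uniq (addIr j)) => /(_ us).
have H : forall n, n \in [seq i + j | i <- s] -> gpart n (v (n - j)).
  by move=> n /mapP[m sm ->]; rewrite addrK; apply: hv.
move=> /(_ H); rewrite big_map (eq_bigr v) => [/(_ s0 (i + j))|m _];
  last by rewrite addrK.
by rewrite addrK; apply; apply: map_f.
Qed.

(* M(j), with M(j)_i = M_(i+j) *)
Definition gshift : gmod :=
  @GMod (gsort M) (fun i u => gpart (i + j) u) (fun i => gpart0 M (i + j))
    (fun i => @gpartD M (i + j)) gshiftZ gshift_span gshift_indep.
End Shift.

Section MonomialIdeal.
Variable s : seq (nat * nat).

Definition mono (ab : nat * nat) : R := xR ^+ ab.1 * yR ^+ ab.2.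

Definition in_mono_ideal (r : R) : Prop := exists c : nat -> R,
  r = \sum_(i < size s) c i * mono (nth (0%N, 0%N) s i).

Definition mono_ideal_pred : pred R^o := fun r => `[< in_mono_ideal r >].

Lemma mono_ideal_closed : submod_closed mono_ideal_pred.
Proof.
split.
  apply/asboolP; exists (fun=> 0); rewrite big1 // => i _; exact: mul0r.
move=> a u v /asboolP[c ->] /asboolP[d ->]; apply/asboolP.
exists (fun i => a * c i + d i).
rewrite scaler_sumr -big_split /=; apply: eq_bigr => i _.
by rewrite mulrDl -mulrA.
Qed.

HB.instance Definition _ :=
  GRing.isSubmodClosed.Build R R^o mono_ideal_pred mono_ideal_closed.

Record mono_ideal := MonoIdeal {
  mideal_val :> R^o;
  _ : mideal_val \in mono_ideal_pred
}.
HB.instance Definition _ := [isSub for mideal_val].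
HB.instance Definition _ := [Choice of mono_ideal by <:].
HB.instance Definition _ := [SubChoice_isSubLmodule of mono_ideal by <:].

Definition mideal_part (i : int) (u : mono_ideal) : Prop :=
  degR i (mideal_val u : R).

Lemma mideal_part0 i : mideal_part i 0.
Proof. exact: degR0. Qed.

Lemma mideal_partD i u v :
  mideal_part i u -> mideal_part i v -> mideal_part i (u + v).
Proof. exact: degRD. Qed.

Lemma mideal_partZ n i r u :
  degR n r -> mideal_part i u -> mideal_part (n + i) (r *: u).
Proof. exact: degRM. Qed.

Lemma mideal_span (u : mono_ideal) :
  exists (n : nat) (d : nat -> int) (v : nat -> mono_ideal),
  (forall i, mideal_part (d i) (v i)) /\ u = \sum_(i < n) v i.
Proof.
pose P (u : mono_ideal) := exists (n : nat) (d : nat -> int)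
  (v : nat -> mono_ideal),
  (forall i, mideal_part (d i) (v i)) /\ u = \sum_(i < n) v i.
have P0 : P 0.
  exists 0%N, (fun=> 0), (fun=> 0); rewrite big_ord0; split=> // i.
  exact: mideal_part0.
have PD v w : P v -> P w -> P (v + w).
  move=> [n [d [f [hf ->]]]] [m [e [g [hg ->]]]].
  exists (n + m)%N, (fun i => if (i < n)%N then d i else e (i - n)%N),
    (fun i => if (i < n)%N then f i else g (i - n)%N); split.
    by move=> i; case: ifP.
  rewrite big_split_ord /=; congr (_ + _); apply: eq_bigr => i _.
    by rewrite ltn_ord.
  by rewrite ltnNge leq_addr /= addKn.
have P1 i v : mideal_part i v -> P v.
  move=> hv; exists 1%N, (fun=> i), (fun=> v); split=> //.
  by rewrite big_ord1.
rewrite -/(P u); case: u => r hr; have /asboolP[c Er] := hr.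
have hm (i : 'I_(size s)) : (mono (nth (0%N, 0%N) s i) : R^o) \in mono_ideal_pred.
  apply/asboolP; exists (fun j => (j == i :> nat)%:R).
  rewrite (bigD1 i) //= eqxx mul1r big1 ?addr0 // => j ne.
  by rewrite (inj_eq val_inj) (negPf ne) mul0r.
pose g i := MonoIdeal (hm i).
have -> : MonoIdeal hr = \sum_(i < size s) c i *: g i.
  apply: val_inj; rewrite raddf_sum /=; rewrite Er.
  by apply: eq_bigr => i _.
apply: big_ind => // i _.
rewrite [c i]truncR_sum_mono scaler_suml.
apply: big_ind => // a _.
rewrite scaler_suml; apply: big_ind => // b _.
apply: (P1 (0 + (a%:Z - b%:Z)
   + ((nth (0%N, 0%N) s i).1%:Z - (nth (0%N, 0%N) s i).2%:Z))).
apply: mideal_partZ; last exact: degR_mono.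
by apply: degRM; [exact: degR_cst | exact: degR_mono].
Qed.

Lemma mideal_indep (t : seq int) (v : int -> mono_ideal) :
  uniq t -> (forall i, i \in t -> mideal_part i (v i)) ->
  \sum_(i <- t) v i = 0 -> forall i, i \in t -> v i = 0.
Proof.
move=> ut hv s0 i ti; apply: val_inj => /=.
apply: (degR_indep ut hv) => //.
by have := congr1 val s0; rewrite raddf_sum.
Qed.

Definition gmono_ideal : gmod :=
  @GMod mono_ideal mideal_part mideal_part0 mideal_partD mideal_partZ
    mideal_span mideal_indep.
End MonomialIdeal.

End GradedModules.
Arguments gpart {F k g} i u.

Section Homological.
Variable A : comNzRingType.

Definition finitely_generated (M : lmodType A) : Prop :=
  exists (n : nat) (g : 'I_n -> M),
    forall u, exists a : 'I_n -> A, u = \sum_(i < n) a i *: g i.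

Definition projective (P : lmodType A) : Prop :=
  forall (N N' : lmodType A) (g : {linear N -> N'}) (f : {linear P -> N'}),
    (forall v, exists u, g u = v) ->
    exists h : {linear P -> N}, forall p, g (h p) = f p.

Record proj_resolution (M : lmodType A) := ProjResolution {
  pres :> nat -> lmodType A;
  pres_d : forall n, {linear pres n.+1 -> pres n};
  pres_aug : {linear pres 0%N -> M};
  pres_proj : forall n, projective (pres n);
  pres_aug_surj : forall u, exists p, pres_aug p = u;
  pres_exact0 : forall p, pres_aug p = 0 <-> exists q, p = pres_d 0%N q;
  pres_exactS : forall n p,
    pres_d n p = 0 <-> exists q, p = pres_d n.+1 q
}.

(* Ext^(i+1)_A(M, N) = 0: the cochain complex Hom(P, N) is exact in degree
   i+1 for a projective resolution P of M (the choice of P is immaterial). *)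
Definition Ext_succ_vanishes (i : nat) (M N : lmodType A) : Prop :=
  exists P : proj_resolution M,
    forall f : {linear P i.+1 -> N}, (forall q, f (pres_d P i.+1 q) = 0) ->
    exists g : {linear P i -> N}, forall p, f p = g (pres_d P i p).
End Homological.

Section ExactCategory.
Variables (F : fieldType) (k : nat).
Local Notation R := (truncR F k).
Local Notation gmod := (gmod F k).

Definition MCM (M : gmod) : Prop :=
  finitely_generated M /\ forall i, Ext_succ_vanishes i M R^o.

(* The conflations 0 -> B -> E -> A -> 0 of MCM_Z R; A and B are meant to be
   objects of that category themselves. *)
Record extension (A B : gmod) := Extension {
  emid :> gmod;
  einj : {linear B -> emid};
  eproj : {linear emid -> A};
  emid_MCM : MCM emid;
  einj_hom : homogeneous einj;
  eproj_hom : homogeneous eproj;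
  einj_inj : injective einj;
  eproj_surj : forall a, exists e, eproj e = a;
  eexact : forall e, eproj e = 0 <-> exists b, e = einj b
}.

Variables A B : gmod.

Definition ext_equiv (E E' : extension A B) : Prop :=
  exists f : {linear E -> E'}, homogeneous f /\
    (forall b, f (einj E b) = einj E' b) /\
    (forall e, eproj E' (f e) = eproj E e).

(* E' represents c . [E]: it is the pushout of E along c . id_B. *)
Definition ext_scale (c : F) (E E' : extension A B) : Prop :=
  exists f : {linear E -> E'}, homogeneous f /\
    (forall b, f (einj E b) = einj E' (cstR c *: b)) /\
    (forall e, eproj E' (f e) = eproj E e).

(* E'' represents the Baer sum [E] + [E']: a graded map s from the fibre
   product E x_A E' to E'', lying over A and restricting to the addition
   B (+) B -> B, identifies E'' with the quotient of E x_A E' by the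
   antidiagonal {(b, -b)}.  Values of s off the fibre product are irrelevant. *)
Definition baer_sum (E E' E'' : extension A B) : Prop :=
  exists s : E -> E' -> E'',
    (forall (r : R) e1 e1' e2 e2',
       eproj E e1 = eproj E' e1' -> eproj E e2 = eproj E' e2' ->
       s (r *: e1 + e2) (r *: e1' + e2') = r *: s e1 e1' + s e2 e2') /\
    (forall i e e', eproj E e = eproj E' e' ->
       gpart i e -> gpart i e' -> gpart i (s e e')) /\
    (forall e e', eproj E e = eproj E' e' -> eproj E'' (s e e') = eproj E e) /\
    (forall b b', s (einj E b) (einj E' b') = einj E'' (b + b')).

(* Ext^1(A, B), i.e. extensions up to equivalence with the Baer sum and the
   scalar action, is F-linearly isomorphic to F^d. *)
Definition dim_Ext1 (d : nat) : Prop :=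
  exists phi : extension A B -> 'rV[F]_d,
    (forall v, exists E, phi E = v) /\
    (forall E E', phi E = phi E' <-> ext_equiv E E') /\
    (forall E E' E'', phi E'' = phi E + phi E' <-> baer_sum E E' E'') /\
    (forall c E E', phi E' = c *: phi E <-> ext_scale c E E').
End ExactCategory.

(* The i-th smallest element of l, counting from 1. *)
Definition elt (l : {fset int}) (i : nat) : int :=
  nth 0 (sort <=%R (enum_fset l)) i.-1.

Section Ksubsets.
Variable k : nat.

(* i_j for 0 <= j <= k-1; here i_0 = 0, and all i_j are >= 0 when #|l| = k. *)
Definition expo (l : {fset int}) (j : nat) : int :=
  elt l k - elt l (k - j)%N - j%:Z.

Definition Iell (F : fieldType) (l : {fset int}) : gmod F k :=
  gshift
    (gmono_ideal F k [seq ((k - 1 - j)%N, `|expo l j|%N) | j <- iota 0 k])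
    (k%:Z - 1 - elt l k).

Definition Dplus (p i j : nat) : bool :=
  [&& (1 <= i <= k)%N, (1 <= j <= k)%N & j%:Z - i%:Z == k%:Z - p%:Z].
Definition Dminus (p i j : nat) : bool :=
  [&& (1 <= i <= k)%N, (1 <= j <= k)%N & i%:Z - j%:Z == k%:Z - p%:Z].

Definition alpha (l m : {fset int}) : nat :=
  (\max_(1 <= p < k.+1 |
      `[< forall i j, Dplus p i j -> (elt l i <= elt m j)%R >])
    p)%N.
Definition beta (l m : {fset int}) : nat :=
  (\max_(1 <= p < k.+1 |
      `[< forall i j, Dminus p i j -> (elt l i >= elt m j)%R >])
    p)%N.
End Ksubsets.

(* Main.v *)
(* R-modules in MCM_Z R are graded free over P = C[y], with x acting by a
   nilpotent matrix.  In the basis e_p of degree l_p, I(l) has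
   x e_p = y^(l_{p+1} - l_p - 1) e_{p+1}.  An extension E of I(l) by I(m) splits
   over P, so it is given by a degree 1 block phi in the matrix of x on E,
   subject to x^k = 0, and it is determined up to X_A h - h X_B with h of degree
   0.  Conversely every such block matrix X defines an object of MCM_Z R, by the
   matrix factorization (x - X) * sum_i x^i X^(k-1-i) = x^k.  Setting y = 1 turns
   X_A and X_B into the nilpotent Jordan block J and the grading into a support
   condition: l_p < m_q on the entries (p, q) of phi, l_p <= m_q on those of h.
   The cocycle condition says that the sums of phi along the main diagonal and
   the diagonals below it vanish, and J h = h J exactly for upper triangular
   Toeplitz h.  So cocycles have dimension
   #{l_p < m_q} - #{lower diagonals meeting the support} = #{l_p < m_q} - (k - beta),
   and coboundaries #{l_p <= m_q} - #{upper diagonals inside the support}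
   = #{l_p <= m_q} - alpha; the two counts of pairs differ by the
   number of common elements of l and m. *)
Require Import Defs.
From HB Require Import structures.
From mathcomp Require Import all_boot all_order all_algebra finmap.
From mathcomp Require Import boolp reals.
From mathcomp Require Import zify.
From mathcomp.real_closed Require Import complex.
Set Implicit Arguments.
Unset Strict Implicit.
Unset Printing Implicit Defensive.
Import Order.TTheory GRing.Theory Num.Theory.
Local Open Scope ring_scope.

(** * The truncated polynomial ring *)

Section TruncatedPolynomials.
Variables (F : fieldType) (k : nat).
Local Notation P := {poly F}.
Local Notation R := (truncR F k).
Local Notation red := (in_qpoly ('X^k : {poly P}) : {poly P} -> R).

Definition yR_poly (p : P) : R := qpolyC 'X^k p.

HB.instance Definition _ := GRing.RMorphism.copy yR_poly (qpolyC ('X^k : {poly P})).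

Lemma yR_polyE p : yR_poly p = red p%:P.
Proof. exact: qpolyC_in. Qed.

Lemma polyn_truncRK (r : R) : red (r : {poly P}) = r.
Proof.
by apply: val_inj; rewrite /= Pdiv.CommonRing.rmodp_small // size_mk_monic.
Qed.

(** By Horner's scheme, [R] is generated as a ring by F[y] and [xR]. This reduces statements about
    all scalars of [R] to these two cases. *)
Lemma truncR_ind (Q : R -> Prop) :
  (forall p, Q (yR_poly p)) -> (forall r s, Q r -> Q s -> Q (r + s)) ->
  (forall r, Q r -> Q (r * xR)) -> forall r, Q r.
Proof.
move=> QC QD QX r; rewrite -(polyn_truncRK r).
elim/poly_ind: (r : {poly P}) => [|p c IH].
  by rewrite in_qpoly0 -(rmorph0 yR_poly); apply: QC.
by rewrite in_qpolyD in_qpolyM -yR_polyE; apply: QD => //; apply: QX.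
Qed.

Lemma red_eq0 (p : {poly P}) : red p = 0 -> exists q, p = q * 'X^k.
Proof.
move=> /(congr1 val) /= h.
(* The library quotient by ['X^0] is really one by ['X], so [k = 0] is treated apart; there every
   polynomial is a multiple of ['X^0 = 1]. *)
case: k h => [|k0] h; first by exists p; rewrite expr0 mulr1.
exists (drop_poly k0.+1 p).
rewrite -{1}(poly_take_drop k0.+1 p).
by move: h; rewrite mk_monic_Xn -Pdiv.RingMonic.take_poly_rmodp /= => ->; rewrite add0r.
Qed.

Lemma red_take (hk : (0 < k)%N) p : red p = take_poly k p :> {poly P}.
Proof.
case: k hk p => // k0 _ p.
by rewrite /= mk_monic_Xn -Pdiv.RingMonic.take_poly_rmodp.
Qed.

Lemma redXk (hk : (0 < k)%N) : red 'X^k = 0.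
Proof.
apply: val_inj; rewrite [LHS]red_take //.
by apply/polyP => i; rewrite coef_take_poly coefXn coef0; case: ltngtP.
Qed.

Lemma red_mxK m n (v : 'M[R]_(m, n)) :
  map_mx red (map_mx (fun r : R => r : {poly P}) v) = v.
Proof. by apply/matrixP => i j; rewrite !mxE polyn_truncRK. Qed.

(** Lift [v] to [v'] over F[y][x]: then [v' A = x^k w], multiplying by [B] gives [x^k v' = x^k w B],
    and [x^k] cancels in the domain F[y][x]. *)
Lemma matrix_factorization_exact n (A B : 'M[{poly P}]_n) :
  A *m B = 'X^k%:M -> B *m A = 'X^k%:M ->
  forall m (v : 'M[R]_(m, n)), v *m map_mx red A = 0 ->
  exists w, v = w *m map_mx red B.
Proof.
move=> AB BA m v vA0.
pose v' := map_mx (fun r : R => r : {poly P}) v.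
have /choice[q hq] : forall ij : 'I_m * 'I_n, exists q, (v' *m A) ij.1 ij.2 = q * 'X^k.
  move=> [i j]; apply: red_eq0.
  have := congr1 (fun M : 'M_(m, n) => M i j) vA0.
  by rewrite -(red_mxK v) -map_mxM !mxE.
pose w := \matrix_(i < m, j < n) q (i, j).
exists (map_mx red w); rewrite -map_mxM -{1}(red_mxK v); congr (map_mx _ _).
have v'A : v' *m A = 'X^k *: w.
  by apply/matrixP => i j; rewrite (hq (i, j)) !mxE mulrC.
have : 'X^k *: v' = 'X^k *: (w *m B).
  by rewrite -mul_mx_scalar -AB mulmxA v'A -scalemxAl.
move=> /matrixP h; apply/matrixP => i j.
have := h i j; rewrite !mxE; apply: mulfI.
by rewrite -size_poly_eq0 size_polyXn.
Qed.

End TruncatedPolynomials.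

(** * Modules given by a nilpotent matrix *)

Definition mk_linear (A : nzRingType) (U V : lmodType A) (f : U -> V)
    (f_lin : linear f) : {linear U -> V} :=
  HB.pack f (GRing.isLinear.Build A U V *:%R f f_lin).

Lemma projective_rV (A : comNzRingType) n : projective ('rV[A]_n).
Proof.
move=> N N' g f g_surj.
have /choice[t ht] : forall i : 'I_n, exists v, g v = f (delta_mx 0 i).
  by move=> i; apply: g_surj.
pose h (v : 'rV[A]_n) := \sum_i v 0 i *: t i.
have h_lin : linear h.
  move=> a u v; rewrite /h scaler_sumr -big_split; apply: eq_bigr => i _ /=.
  by rewrite !mxE scalerDl scalerA.
exists (mk_linear h_lin) => v /=.
rewrite /h linear_sum {2}[v]row_sum_delta linear_sum; apply: eq_bigr => i _.
by rewrite !linearZ /= ht.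
Qed.

Lemma linear_rV_regular (A : comNzRingType) n (f : {linear 'rV[A]_n -> A^o}) :
  exists c : 'cV[A]_n, forall v, f v = (v *m c) 0 0.
Proof.
exists (\col_i f (delta_mx 0 i)) => v.
rewrite {1}[v]row_sum_delta linear_sum mxE; apply: eq_bigr => i _.
by rewrite linearZ /= mxE.
Qed.

Section MatrixModule.
Variables (F : fieldType) (k n : nat).
Local Notation P := {poly F}.
Local Notation R := (truncR F k).
Local Notation red := (in_qpoly ('X^k : {poly P}) : {poly P} -> R).

Definition nilp_act (X : 'M[P]_n.+1) (r : R) : 'M[P]_n.+1 :=
  horner_mx X (r : {poly P}).

Variables (X : 'M[P]_n.+1).
Hypothesis X_nil : X ^+ k = 0.

Lemma nilp_gt0 : (0 < k)%N.
Proof.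
by rewrite lt0n; apply/eqP => k0; move/eqP: X_nil; rewrite k0 expr0 oner_eq0.
Qed.

(** Reduction changes [p] by a multiple of ['X^k], which vanishes at [X]. Hence evaluating canonical
    representatives at [X] is multiplicative. *)
Lemma nilp_act_red p : nilp_act X (red p) = horner_mx X p.
Proof.
rewrite /nilp_act red_take ?nilp_gt0 //.
rewrite -[in RHS](poly_take_drop k p) rmorphD rmorphM rmorphXn /=.
by rewrite horner_mx_X X_nil mulr0 addr0.
Qed.

Lemma nilp_actM r s : nilp_act X (r * s) = nilp_act X r * nilp_act X s.
Proof.
rewrite -{1}(polyn_truncRK r) -{1}(polyn_truncRK s) -in_qpolyM nilp_act_red.
exact: rmorphM.
Qed.

Lemma nilp_actD r s : nilp_act X (r + s) = nilp_act X r + nilp_act X s.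
Proof. exact: rmorphD. Qed.

Lemma nilp_act_poly p : nilp_act X (yR_poly k p) = p%:M.
Proof. by rewrite yR_polyE nilp_act_red horner_mx_C. Qed.

Lemma nilp_actX : nilp_act X xR = X.
Proof. by rewrite nilp_act_red horner_mx_X. Qed.

Lemma nilp_act1 : nilp_act X 1 = 1.
Proof. by rewrite -in_qpoly1 nilp_act_red rmorph1. Qed.

(** The nilpotency proof is an argument of the type, so that the [R]-module structure below can be
    inferred from the type alone. *)
Definition mxmod of X ^+ k = 0 := 'rV[P]_n.+1.
Local Notation M := (mxmod X_nil).

HB.instance Definition _ := GRing.Zmodule.on M.

Definition mxmod_scale (r : R) (v : M) : M := v *m nilp_act X r.

Fact mxmod_scaleA a b v : mxmod_scale a (mxmod_scale b v) = mxmod_scale (a * b) v.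
Proof. by rewrite /mxmod_scale mulrC nilp_actM mulmxA. Qed.
Fact mxmod_scale1 : left_id 1 mxmod_scale.
Proof. by move=> v; rewrite /mxmod_scale nilp_act1 mulmx1. Qed.
Fact mxmod_scaleDr : right_distributive mxmod_scale +%R.
Proof. by move=> r u v; apply: mulmxDl. Qed.
Fact mxmod_scaleDl v : {morph mxmod_scale^~ v : a b / a + b}.
Proof. by move=> r s; rewrite /mxmod_scale nilp_actD mulmxDr. Qed.

HB.instance Definition _ := GRing.Zmodule_isLmodule.Build R M
  mxmod_scaleA mxmod_scale1 mxmod_scaleDr mxmod_scaleDl.

Lemma mxmod_scaleE (r : R) (v : M) : r *: v = v *m nilp_act X r :> 'rV_n.+1.
Proof. by []. Qed.

Definition mf_diff : 'M[{poly P}]_n.+1 := 'X%:M - map_mx polyC X.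
(** The cofactor of [x - X] in [x^k - X^k], which equals [x^k] here. *)
Definition mf_norm : 'M[{poly P}]_n.+1 :=
  \sum_(i < k) 'X%:M ^+ (k.-1 - i) * map_mx polyC X ^+ i.

Lemma mf_comm : GRing.comm ('X%:M : 'M[{poly P}]_n.+1) (map_mx polyC X).
Proof. by first [exact: scalar_mxC | exact: (esym (scalar_mxC _ _))]. Qed.

Lemma scalar_mxX (A : comNzRingType) (a : A) (i : nat) :
  (a%:M : 'M[A]_n.+1) ^+ i = (a ^+ i)%:M.
Proof. by rewrite -(rmorphXn (@scalar_mx A n.+1)). Qed.

Lemma map_polyC_mxX i : map_mx polyC (X ^+ i) = map_mx polyC X ^+ i.
Proof.
elim: i => [|i IH]; first by rewrite !expr0 map_mx1.
by rewrite !exprS -IH; exact: map_mxM.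
Qed.

Lemma mf_diffK : mf_diff *m mf_norm = 'X^k%:M.
Proof.
have := subrXX_comm k mf_comm.
by rewrite -map_polyC_mxX X_nil map_mx0 subr0 scalar_mxX => ->.
Qed.

Lemma mf_normK : mf_norm *m mf_diff = 'X^k%:M.
Proof.
rewrite -mf_diffK; suff : GRing.comm mf_norm mf_diff by [].
apply: commrB; apply: commr_sym; apply: commr_sum => i _; apply: commrM;
  apply: commrX => //; first exact: mf_comm.
exact/commr_sym/mf_comm.
Qed.

(** The differentials of the 2-periodic resolution attached to a matrix factorization, acting on row
    vectors from the right. *)
Definition mxres_d (i : nat) : 'M[R]_n.+1 :=
  map_mx red (if odd i then mf_norm else mf_diff).

Lemma mxres_exact (i : nat) m (v : 'M[R]_(m, n.+1)) :
  v *m mxres_d i = 0 -> exists w, v = w *m mxres_d i.+1.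
Proof.
rewrite /mxres_d /=; case: (odd i); apply: matrix_factorization_exact;
  by rewrite ?mf_normK ?mf_diffK.
Qed.

(** This is exactness after applying Hom(-, R): the transposed factors again form a matrix
    factorization of [x^k]. *)
Lemma mxres_exact_tr (i : nat) m (v : 'M[R]_(n.+1, m)) :
  mxres_d i.+1 *m v = 0 -> exists w, v = mxres_d i *m w.
Proof.
move=> /(congr1 trmx); rewrite trmx_mul trmx0 /mxres_d => vD.
suff [w hw] : exists w, v^T = w *m (map_mx red (if odd i then mf_norm else mf_diff))^T.
  by exists w^T; rewrite -[v]trmxK hw trmx_mul trmxK.
move: vD; rewrite !map_trmx /=.
by case: (odd i); apply: matrix_factorization_exact;
  rewrite -trmx_mul ?mf_normK ?mf_diffK tr_scalar_mx.
Qed.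

Lemma red_Xk : red 'X^k = 0.
Proof.
exact/redXk/nilp_gt0.
Qed.

Lemma mxres_dd i : mxres_d i.+1 *m mxres_d i = 0.
Proof.
rewrite /mxres_d -map_mxM /=.
by case: (odd i); rewrite /= ?mf_normK ?mf_diffK map_scalar_mx /= red_Xk raddf0.
Qed.

Definition mxmod_basis (i : 'I_n.+1) : M := delta_mx 0 i.

Definition mxmod_aug (w : 'rV[R]_n.+1) : M := \sum_i w 0 i *: mxmod_basis i.

Lemma mxmod_aug_linear : linear mxmod_aug.
Proof.
move=> a u v; rewrite /mxmod_aug scaler_sumr -big_split; apply: eq_bigr => i _ /=.
by rewrite !mxE scalerDl scalerA.
Qed.

Definition mxmod_augL := mk_linear mxmod_aug_linear.

Lemma mxmod_augK (v : 'rV[P]_n.+1) : mxmod_aug (map_mx (@yR_poly F k) v) = v.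
Proof.
rewrite /mxmod_aug [RHS]row_sum_delta; apply: eq_bigr => i _.
by rewrite mxE mxmod_scaleE nilp_act_poly mul_mx_scalar.
Qed.

Lemma mxres_d0E : mxres_d 0 = xR%:M - map_mx (@yR_poly F k) X.
Proof.
rewrite /mxres_d /= map_mxB map_scalar_mx -map_mx_comp; congr (_ - _).
by apply/matrixP => i j; rewrite !mxE yR_polyE.
Qed.

Lemma mxmod_aug_d0 (q : 'rV[R]_n.+1) : mxmod_aug (q *m mxres_d 0) = 0.
Proof.
have augK v : mxmod_augL (map_mx (@yR_poly F k) v) = v := mxmod_augK v.
rewrite (_ : mxmod_aug _ = mxmod_augL (q *m mxres_d 0)) //.
rewrite [q]row_sum_delta mulmx_suml linear_sum big1 // => i _.
rewrite -scalemxAl linearZZ mxres_d0E mulmxBr mul_mx_scalar.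
rewrite -[delta_mx 0 i](map_delta_mx (@yR_poly F k)) -map_mxM.
by rewrite linearB linearZZ !augK [xR *: _]mxmod_scaleE nilp_actX subrr scaler0.
Qed.

(* Modulo the image of x - X, multiplication by x acts as X, so every vector
   over R reduces to one with entries in F[y], namely its augmentation. *)
Lemma mxmod_aug_red (w : 'rV[R]_n.+1) :
  exists q, w = q *m mxres_d 0 + map_mx (@yR_poly F k) (mxmod_aug w).
Proof.
pose Q (r : R) := forall v : 'rV[P]_n.+1, exists q, r *: map_mx (@yR_poly F k) v =
  q *m mxres_d 0 + map_mx (@yR_poly F k) (r *: (v : M)).
have allQ : forall r, Q r.
  apply: truncR_ind => [p|r s Qr Qs|r Qr] v.
  - exists 0; rewrite mul0mx add0r mxmod_scaleE nilp_act_poly mul_mx_scalar.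
    by apply/matrixP => i j; rewrite !mxE rmorphM.
  - have [q1 h1] := Qr v; have [q2 h2] := Qs v.
    exists (q1 + q2); rewrite !scalerDl h1 h2 mulmxDl.
    by rewrite (map_mxD (@yR_poly F k)) addrACA.
  have [q hq] := Qr (v *m X).
  exists (r *: map_mx (@yR_poly F k) v + q).
  rewrite mulmxDl -scalemxAl -addrA -scalerA.
  rewrite (_ : (r * xR) *: (v : M) = r *: (v *m X : M)); last first.
    by rewrite -scalerA [xR *: _]mxmod_scaleE nilp_actX.
  rewrite -hq mxres_d0E mulmxBr mul_mx_scalar map_mxM scalerBr subrK //.
have /choice[q hq] : forall i : 'I_n.+1, exists q,
    w 0 i *: map_mx (@yR_poly F k) (delta_mx 0 i) = q *m mxres_d 0 +
      map_mx (@yR_poly F k) (w 0 i *: (delta_mx 0 i : M)).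
  by move=> i; apply: allQ.
exists (\sum_i q i).
rewrite {1}[w]row_sum_delta mulmx_suml /mxmod_aug.
rewrite (raddf_sum (map_mx (@yR_poly F k))) -big_split; apply: eq_bigr => i _ /=.
by rewrite -hq map_delta_mx.
Qed.

Definition mxmod_resolution : proj_resolution M.
Proof.
refine (@ProjResolution R M (fun=> 'rV[R]_n.+1)
  (fun i => mk_linear (fun a u v => linearP (mulmxr (mxres_d i)) a u v))
  mxmod_augL _ _ _ _).
- by move=> _; apply: projective_rV.
- by move=> u; exists (map_mx (@yR_poly F k) u); apply: mxmod_augK.
- move=> p; split=> /= [p0|[q ->]]; last exact: mxmod_aug_d0.
  have [q hq] := mxmod_aug_red p; exists q.
  by rewrite {1}hq p0 map_mx0 addr0.
- move=> i p; split=> /= [/mxres_exact//|[q ->]].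
  by rewrite -mulmxA mxres_dd mulmx0.
Defined.

Lemma mxmod_fg : finitely_generated M.
Proof.
exists n.+1, mxmod_basis => u; exists (fun i => yR_poly k (u 0 i)).
rewrite -{1}(mxmod_augK u); apply: eq_bigr => i _; by rewrite mxE.
Qed.

(** A cochain with values in [R] is a column [c]. The cocycle condition says
    [mxres_d i.+1 *m c = 0], and exactness of the transposed complex gives [c = mxres_d i *m c']. *)
Lemma mxmod_Ext_vanishes i : Ext_succ_vanishes i M R^o.
Proof.
exists mxmod_resolution => f; have [c hc] := linear_rV_regular f.
move=> fd.
have /mxres_exact_tr[c' hc'] : mxres_d i.+1 *m c = 0.
  apply/row_matrixP => j; rewrite row0 row_mul.
  apply/matrixP => a b; rewrite !ord1 [RHS]mxE -hc.
  by rewrite rowE -(fd (delta_mx 0 j)).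
have g_lin : linear (fun v : 'rV[R]_n.+1 => (v *m c') 0 0 : R^o).
  by move=> a u v; rewrite mulmxDl -scalemxAl !mxE.
exists (mk_linear g_lin) => p /=.
by rewrite hc hc' mulmxA.
Qed.

End MatrixModule.

(** * Graded matrices and graded modules *)

Section GradedMatrices.
Variable F : fieldType.
Local Notation P := {poly F}.

(* Matrix of a degree s map between graded free F[y]-modules with bases in
   degrees d and d'; as deg y = -1, entry (p, q) is a multiple of
   y^(d' q - d p - s). *)
Definition hmx m n (d : 'I_m -> int) (d' : 'I_n -> int) (s : int)
    (M : 'M[P]_(m, n)) : Prop :=
  forall p q b, (M p q)`_b != 0 -> d' q - b%:Z = d p + s.

(** A vector is treated as a map from a free module with one generator in degree 0, so that
    [hmx_mul] also gives the degree of a vector times a matrix. *)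
Definition hrow n (d : 'I_n -> int) (i : int) (v : 'rV[P]_n) : Prop :=
  hmx (fun=> 0) d i v.

Lemma hrowP n (d : 'I_n -> int) i (v : 'rV[P]_n) :
  hrow d i v <-> forall q b, (v 0 q)`_b != 0 -> d q - b%:Z = i.
Proof.
split=> [h q b /h|h p q b]; first by rewrite add0r.
by rewrite ord1 add0r => /h.
Qed.

Variables (m n : nat) (d : 'I_m -> int) (d' : 'I_n -> int).

Lemma hmx0 s : hmx d d' s 0.
Proof. by move=> p q b; rewrite mxE coef0 eqxx. Qed.

Lemma hmxD s M N : hmx d d' s M -> hmx d d' s N -> hmx d d' s (M + N).
Proof.
move=> hM hN p q b; rewrite mxE coefD.
have [->|/hM //] := eqVneq (M p q)`_b 0.
by rewrite add0r => /hN.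
Qed.

Lemma hmxZ s (c : F) M : hmx d d' s M -> hmx d d' s (c%:P *: M).
Proof.
move=> hM p q b; rewrite mxE coefCM; have [->|/hM //] := eqVneq (M p q)`_b 0.
by rewrite mulr0 eqxx.
Qed.

Lemma hmxN s M : hmx d d' s M -> hmx d d' s (- M).
Proof. by move=> hM p q b; rewrite mxE coefN oppr_eq0 => /hM. Qed.

Lemma hmx_sum s I (r : seq I) (Q : pred I) (M : I -> 'M[P]_(m, n)) :
  (forall i, Q i -> hmx d d' s (M i)) -> hmx d d' s (\sum_(i <- r | Q i) M i).
Proof. by move=> h; apply: big_ind => //; [apply: hmx0 | apply: hmxD]. Qed.

Lemma hmx_row s M : hmx d d' s M <-> forall p, hrow d' (d p + s) (row p M).
Proof.
split=> [h p|h p q b ne]; first by apply/hrowP => q b; rewrite mxE => /h.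
by have /hrowP/(_ q b) := h p; rewrite mxE; apply.
Qed.

Lemma hmx_mul l (e : 'I_l -> int) s t (M : 'M[P]_(l, m)) (N : 'M[P]_(m, n)) :
  hmx e d s M -> hmx d d' t N -> hmx e d' (s + t) (M *m N).
Proof.
move=> hM hN p q b; rewrite mxE coef_sum.
apply: contraNeq => ne; rewrite big1 // => j _.
rewrite coefM big1 // => i _.
have [->|M0] := eqVneq (M p j)`_i 0; first by rewrite mul0r.
have [->|N0] := eqVneq (N j q)`_(b - i) 0; first by rewrite mulr0.
case/eqP: ne; have := hM _ _ _ M0; have := hN _ _ _ N0.
by have := ltn_ord i; lia.
Qed.

End GradedMatrices.

(** The degree function [e] is spelled out as a [match] so that it is convertible with [chart_deg]
    below. *)
Lemma hmx_block (F : fieldType) n (d d' : 'I_n -> int) s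
    (A B C D : 'M[{poly F}]_n) (e := fun i : 'I_(n + n) =>
      match split i with inl j => d j | inr j => d' j end) :
  hmx e e s (block_mx A B C D) <->
  [/\ hmx d d s A, hmx d d' s B, hmx d' d s C & hmx d' d' s D].
Proof.
have el j : e (lshift n j) = d j by rewrite /e (unsplitK (inl j)).
have er j : e (rshift n j) = d' j by rewrite /e (unsplitK (inr j)).
split=> [h|[hA hB hC hD] p q b].
  split=> p q b ne.
  - by have := h (lshift n p) (lshift n q) b; rewrite block_mxEul !el; apply.
  - by have := h (lshift n p) (rshift n q) b; rewrite block_mxEur el er; apply.
  - by have := h (rshift n p) (lshift n q) b; rewrite block_mxEdl el er; apply.
  - by have := h (rshift n p) (rshift n q) b; rewrite block_mxEdr !er; apply.
rewrite -(splitK p) -(splitK q).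
case: (split p) => p'; case: (split q) => q' /=.
- by rewrite block_mxEul !el => /hA.
- by rewrite block_mxEur el er => /hB.
- by rewrite block_mxEdl el er => /hC.
- by rewrite block_mxEdr !er => /hD.
Qed.

Lemma hrow_row_mx (F : fieldType) n (d d' : 'I_n -> int) i (u v : 'rV[{poly F}]_n)
    (e := fun i : 'I_(n + n) =>
      match split i with inl j => d j | inr j => d' j end) :
  hrow e i (row_mx u v) <-> hrow d i u /\ hrow d' i v.
Proof.
have el j : e (lshift n j) = d j by rewrite /e (unsplitK (inl j)).
have er j : e (rshift n j) = d' j by rewrite /e (unsplitK (inr j)).
split=> [/hrowP h|[/hrowP hu /hrowP hv]].
  split; apply/hrowP => q b.
    by have := h (lshift n q) b; rewrite row_mxEl el.
  by have := h (rshift n q) b; rewrite row_mxEr er.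
apply/hrowP => q b; rewrite -(splitK q).
case: (split q) => q' /=.
  by rewrite row_mxEl el => /hu.
by rewrite row_mxEr er => /hv.
Qed.

Lemma sum_pred1_uniq (V : nmodType) (I : eqType) (s : seq I) x (f : I -> V) :
  uniq s -> x \in s -> \sum_(a <- s | a == x) f a = f x.
Proof. by move=> us xs; rewrite -big_filter filter_pred1_uniq // big_seq1. Qed.

Section GradedModuleTheory.
Variables (F : fieldType) (k : nat).
Local Notation P := {poly F}.
Local Notation R := (truncR F k).

Lemma degR_yR_poly i (p : P) : (forall b, p`_b != 0 -> - b%:Z = i) ->
  degR i (yR_poly k p).
Proof.
move=> h a b; rewrite /coefxy /= coefC; case: (eqVneq a 0%N) => [->/h <-|_]; first by rewrite sub0r.
by rewrite coef0 eqxx.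
Qed.

Lemma degR_xR : degR 1 (xR : R).
Proof. by have := degR_mono (F := F) (k := k) (a := 1) (b := 0); rewrite expr1 expr0 mulr1 subr0. Qed.

Lemma gpartN (M : gmod F k) i (u : M) : gpart i u -> gpart i (- u).
Proof.
move=> hu; rewrite -scaleN1r -(add0r i); apply: gpartZ hu.
have := @degR_cst F k (-1).
by rewrite /cstR polyCN polyC1 (rmorphN (@yR_poly F k)) rmorph1.
Qed.

Lemma gpart_sum (M : gmod F k) i I (r : seq I) (Q : pred I) (u : I -> M) :
  (forall j, Q j -> gpart i (u j)) -> gpart i (\sum_(j <- r | Q j) u j).
Proof. by move=> h; apply: big_ind => //; [apply: gpart0 | apply: gpartD]. Qed.

(** [u'] is the degree [i] component of [u], described through maps: if [f u] already has degree
    [i], the other components of [u] contribute nothing to it. *)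
Lemma gcomponent (M : gmod F k) i (u : M) : exists u', gpart i u' /\
  forall (N : gmod F k) (f : {linear M -> N}),
    homogeneous f -> gpart i (f u) -> f u' = f u.
Proof.
have [n [d [v [hv Eu]]]] := gpart_span u.
exists (\sum_(j < n | d j == i) v j); split.
  by apply: gpart_sum => j /eqP <-.
move=> N f hf hfu.
pose s := undup (i :: [seq d j | j <- iota 0 n]).
(* [w a] compares the degree [a] part of [f u] obtained from the [v j] with the one expected when
   [f u] has degree [i]. The [w a] add up to 0, so each of them vanishes. *)
pose w a := \sum_(j < n | d j == a) f (v j) - (if a == i then f u else 0).
have si : i \in s by rewrite mem_undup mem_head.
have us : uniq s by apply: undup_uniq.
have : w i = 0.
  apply: (gpart_indep (g := N) us (v := w)) => // [a _|].
    apply: gpartD; first by apply: gpart_sum => j /eqP <-; apply: hf.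
    by apply: gpartN; case: eqP => [->//|_]; apply: gpart0.
  rewrite sumrB; apply/eqP; rewrite subr_eq0; apply/eqP.
  rewrite -[RHS]big_mkcond sum_pred1_uniq // Eu linear_sum.
  rewrite (exchange_big_dep xpredT) //=; apply: eq_bigr => j _.
  rewrite (eq_bigl (fun a => a == d j)) => [|a]; last by rewrite eq_sym.
  rewrite sum_pred1_uniq // mem_undup inE; apply/orP; right.
  by apply/mapP; exists (nat_of_ord j) => //; rewrite mem_iota /= add0n.
by rewrite /w eqxx linear_sum => /eqP; rewrite subr_eq0 => /eqP.
Qed.

End GradedModuleTheory.

(** * Coordinates *)

Section Coordinates.
Variables (F : fieldType) (k : nat).
Local Notation P := {poly F}.
Local Notation R := (truncR F k).
Local Notation gmod := (gmod F k).

(** A graded isomorphism of [M] with the free F[y]-module whose basis has degrees [d], under which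
    [x] becomes right multiplication by [X]. *)
Record coords (M : gmod) n (d : 'I_n -> int) (X : 'M[P]_n) := Coords {
  crd :> M -> 'rV[P]_n;
  uncrd : 'rV[P]_n -> M;
  crdD : forall u v, crd (u + v) = crd u + crd v;
  crdC : forall p u, crd (yR_poly k p *: u) = p *: crd u;
  crdX : forall u, crd (xR *: u) = crd u *m X;
  crdK : cancel crd uncrd;
  uncrdK : cancel uncrd crd;
  crd_hom : forall i u, gpart i u <-> hrow d i (crd u)
}.

Section Theory.
Variables (M : gmod) (n : nat) (d : 'I_n -> int) (X : 'M[P]_n).
Variable c : coords M d X.

Lemma crd_inj : injective c. Proof. exact: can_inj (crdK c). Qed.

Lemma crd0 : c 0 = 0.
Proof. by have := crdD c 0 0; rewrite addr0 => /eqP; rewrite addrC -subr_eq subrr => /eqP <-. Qed.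

Lemma crd_sum I (r : seq I) (Q : pred I) (u : I -> M) :
  c (\sum_(i <- r | Q i) u i) = \sum_(i <- r | Q i) c (u i).
Proof. exact: (big_morph _ (crdD c) crd0). Qed.

Lemma uncrd0 : uncrd c 0 = 0.
Proof. by apply: crd_inj; rewrite uncrdK crd0. Qed.

Lemma uncrdD u v : uncrd c (u + v) = uncrd c u + uncrd c v.
Proof. by apply: crd_inj; rewrite crdD !uncrdK. Qed.

Lemma uncrdC p u : uncrd c (p *: u) = yR_poly k p *: uncrd c u.
Proof. by apply: crd_inj; rewrite crdC !uncrdK. Qed.

Lemma uncrd_sum I (r : seq I) (Q : pred I) (u : I -> 'rV[P]_n) :
  uncrd c (\sum_(i <- r | Q i) u i) = \sum_(i <- r | Q i) uncrd c (u i).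
Proof. exact: (big_morph _ uncrdD uncrd0). Qed.

Lemma uncrd_hom i v : gpart i (uncrd c v) <-> hrow d i v.
Proof. by rewrite -{2}(uncrdK c v); apply: crd_hom. Qed.

Lemma hrow_delta p : hrow d (d p) (delta_mx 0 p : 'rV[P]_n).
Proof.
apply/hrowP => q b; rewrite mxE /=.
case: (eqVneq q p) => [->|_]; last by rewrite coef0 eqxx.
by rewrite coef1; case: b => [|b]; rewrite ?subr0 // eqxx.
Qed.

(** Row [p] of [X] holds the coordinates of [x e_p], an element of degree [d p + 1]. *)
Lemma coords_hmx : hmx d d 1 X.
Proof.
apply/hmx_row => p; rewrite rowE -[delta_mx 0 p](uncrdK c) -crdX.
apply/crd_hom; rewrite addrC; apply: gpartZ; first exact: degR_xR.
by apply/uncrd_hom/hrow_delta.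
Qed.

Lemma crdXn i u : c (xR ^+ i *: u) = c u *m X ^+ i.
Proof.
elim: i u => [|i IH] u; first by rewrite !expr0 scale1r mulmx1.
by rewrite exprSr -scalerA IH crdX exprS -mulmxA.
Qed.

Lemma coords_nil : (0 < k)%N -> X ^+ k = 0.
Proof.
move=> hk; apply/row_matrixP => p; rewrite row0 rowE -[delta_mx 0 p](uncrdK c).
by rewrite -crdXn -in_qpolyXn redXk // scale0r crd0.
Qed.

End Theory.

Section GradedMatrixModule.
Variables (n : nat) (d : 'I_n.+1 -> int) (X : 'M[P]_n.+1).
Hypothesis X_nil : X ^+ k = 0.
Hypothesis X_hom : hmx d d 1 X.
Local Notation M := (mxmod X_nil).

Definition mxmod_part (i : int) (v : M) : Prop := hrow d i v.

Lemma hmx_exp i : hmx d d i%:Z (X ^+ i).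
Proof.
elim: i => [|i IH].
  move=> p q b; rewrite expr0 mxE mulrb; case: (eqVneq p q) => [->|_].
    by rewrite coef1; case: b => // b; rewrite eqxx.
  by rewrite coef0 eqxx.
by rewrite exprS (_ : i.+1%:Z = 1 + i%:Z) ?intS //; apply: hmx_mul IH.
Qed.

Lemma horner_mxE (p : {poly P}) :
  horner_mx X p = \sum_(i < size p) p`_i *: X ^+ i.
Proof.
rewrite -{1}[p]coefK poly_def rmorph_sum; apply: eq_bigr => i _ /=.
by rewrite horner_mxZ rmorphXn /= horner_mx_X.
Qed.

(** A monomial [x^a y^j] of [r] has [a - j = i]; it contributes [y^j X^a], where [X^a] has degree
    [a]. *)
Lemma hmx_nilp_act i (r : R) : degR i r -> hmx d d i (nilp_act X r).
Proof.
move=> hr; rewrite /nilp_act horner_mxE; apply: hmx_sum => a _ p q b.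
rewrite mxE coefM; apply: contraNeq => ne; rewrite big1 // => j _.
have [->|r0] := eqVneq ((polyn r)`_a)`_j 0; first by rewrite mul0r.
have [->|X0] := eqVneq ((X ^+ a) p q)`_(b - j) 0; first by rewrite mulr0.
case/eqP: ne; have := hmx_exp X0; have := hr _ _ r0.
by have := ltn_ord j; lia.
Qed.

Fact mxmod_part0 i : mxmod_part i 0. Proof. exact: hmx0. Qed.

Fact mxmod_partD i u v :
  mxmod_part i u -> mxmod_part i v -> mxmod_part i (u + v).
Proof. exact: hmxD. Qed.

Fact mxmod_partZ j i (r : R) (u : M) :
  degR j r -> mxmod_part i u -> mxmod_part (j + i) (r *: u).
Proof.
by move=> hr hu; rewrite /mxmod_part addrC; apply: hmx_mul hu (hmx_nilp_act hr).
Qed.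

Fact mxmod_span (u : M) : exists (m : nat) (e : nat -> int) (v : nat -> M),
  (forall i, mxmod_part (e i) (v i)) /\ u = \sum_(i < m) v i.
Proof.
pose Q (u : M) := exists (m : nat) (e : nat -> int) (v : nat -> M),
  (forall i, mxmod_part (e i) (v i)) /\ u = \sum_(i < m) v i.
have Q0 : Q 0.
  by exists 0%N, (fun=> 0), (fun=> 0); rewrite big_ord0; split=> // i; apply: mxmod_part0.
have QD v w : Q v -> Q w -> Q (v + w).
  move=> [m1 [e [f [hf ->]]]] [m2 [e' [g [hg ->]]]].
  exists (m1 + m2)%N, (fun i => if (i < m1)%N then e i else e' (i - m1)%N),
    (fun i => if (i < m1)%N then f i else g (i - m1)%N); split.
    by move=> i; case: ifP.
  rewrite big_split_ord /=; congr (_ + _); apply: eq_bigr => i _.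
    by rewrite ltn_ord.
  by rewrite ltnNge leq_addr /= addKn.
rewrite -/(Q u) [u]row_sum_delta; apply: (big_ind Q) => // q _.
rewrite -[u 0 q]coefK poly_def scaler_suml; apply: (big_ind Q) => // b _.
exists 1%N, (fun=> d q - b%:Z), (fun=> ((u 0 q)`_b *: 'X^b) *: delta_mx 0 q).
rewrite big_ord1; split=> // _; apply/hrowP => q' b'.
rewrite !mxE /=; case: (eqVneq q' q) => [->|_]; last by rewrite mulr0 coef0 eqxx.
rewrite mulr1 coefZ coefXn; case: (eqVneq b' b) => [->//|_].
by rewrite mulr0 eqxx.
Qed.

Fact mxmod_indep (s : seq int) (v : int -> M) :
  uniq s -> (forall i, i \in s -> mxmod_part i (v i)) -> \sum_(i <- s) v i = 0 ->
  forall i, i \in s -> v i = 0.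
Proof.
move=> us hv s0 i si; apply/rowP => q; rewrite [RHS]mxE.
apply/polyP => b; rewrite coef0; apply/eqP.
have := congr1 (fun w : 'rV[P]_n.+1 => (w 0 q)`_b) s0.
rewrite /= summxE coef_sum mxE coef0 (bigD1_seq i) //=.
have [//|ne] := eqVneq (v i 0 q)`_b 0.
rewrite big1_seq ?addr0 => [/eqP|j /andP[ij js]]; first by rewrite (negPf ne).
apply/eqP; apply: contraNT ij => ne'.
have /hrowP/(_ _ _ ne') <- := hv j js.
by have /hrowP/(_ _ _ ne) <- := hv i si.
Qed.

Definition gmxmod : gmod := @GMod F k M mxmod_part mxmod_part0 mxmod_partD
  mxmod_partZ mxmod_span mxmod_indep.

Definition gmxmod_coords : coords gmxmod d X.
Proof.
refine (@Coords gmxmod n.+1 d X (fun v => v) (fun v => v) _ _ _ _ _ _) => //.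
- move=> p u; rewrite (mxmod_scaleE (X_nil := X_nil)) (nilp_act_poly X_nil).
  exact: mul_mx_scalar.
- by move=> u; rewrite (mxmod_scaleE (X_nil := X_nil)) (nilp_actX X_nil).
Defined.

Lemma gmxmod_MCM : MCM gmxmod.
Proof.
split; first exact: mxmod_fg.
by move=> i; apply: mxmod_Ext_vanishes.
Qed.

End GradedMatrixModule.
End Coordinates.

Arguments crd_inj {F k M n d X} c [x1 x2] _.

(** * Charts of extensions *)

Section Charts.
Variables (F : fieldType) (k n : nat).
Local Notation P := {poly F}.
Local Notation R := (truncR F k).
Local Notation gmod := (gmod F k).
Variables (A B : gmod) (dA dB : 'I_n -> int) (XA XB : 'M[P]_n).
Variables (cA : coords A dA XA) (cB : coords B dB XB).

Definition chart_deg (i : 'I_(n + n)) : int :=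
  match split i with inl j => dB j | inr j => dA j end.

(** Matrices act on row vectors, so the lower rows describe [x] on lifts of the basis of [A]; the
    zero block says that [B] is a submodule. *)
Definition chart_mx (phi : 'M[P]_n) : 'M[P]_(n + n) := block_mx XB 0 phi XA.

Record chart (E : extension A B) (phi : 'M[P]_n) := Chart {
  chart_crd :> coords E chart_deg (chart_mx phi);
  chart_inj : forall b, chart_crd (einj E b) = row_mx (cB b) 0;
  chart_proj : forall e, rsubmx (chart_crd e) = cA (eproj E e)
}.

Lemma chart_hmx E phi : chart E phi -> hmx dA dB 1 phi.
Proof. by move=> c; have /hmx_block[] := coords_hmx c. Qed.

(** The degree [i] component of [b] has the same image as [b], and [einj] is injective. *)
Lemma einj_reflects_hom (E : extension A B) i b :
  gpart i (einj E b) -> gpart i b.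
Proof.
move=> hb; have [b' [hb' Eb']] := gcomponent i b.
by rewrite -(einj_inj (Eb' _ _ (einj_hom E) hb)).
Qed.

Lemma eproj_lift_hom (E : extension A B) i a :
  gpart i a -> exists2 e, gpart i e & eproj E e = a.
Proof.
move=> ha; have [e Ee] := eproj_surj E a.
have [e' [he' Ee']] := gcomponent i e.
exists e' => //; rewrite -Ee; apply: Ee'; first exact: eproj_hom.
by rewrite Ee.
Qed.

Lemma eproj_inj (E : extension A B) b : eproj E (einj E b) = 0.
Proof. by apply/eexact; exists b. Qed.

Section ChartExists.
Variable E : extension A B.
Variable t : 'I_n -> E.
Hypothesis t_hom : forall p, gpart (dA p) (t p).
Hypothesis t_lift : forall p, eproj E (t p) = uncrd cA (delta_mx 0 p).

(** A homogeneous F[y]-linear splitting of [eproj], in general not [R]-linear. *)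
Let sec (v : 'rV[P]_n) : E := \sum_p yR_poly k (v 0 p) *: t p.

Let secD u v : sec (u + v) = sec u + sec v.
Proof.
by rewrite /sec -big_split; apply: eq_bigr => p _; rewrite mxE rmorphD scalerDl.
Qed.

Let secC p u : sec (p *: u) = yR_poly k p *: sec u.
Proof.
by rewrite /sec scaler_sumr; apply: eq_bigr => j _; rewrite mxE rmorphM scalerA.
Qed.

Let sec0 : sec 0 = 0.
Proof. by have := secC 0 0; rewrite scale0r rmorph0 scale0r. Qed.

Let eproj_sec v : eproj E (sec v) = uncrd cA v.
Proof.
rewrite linear_sum [v in RHS]row_sum_delta uncrd_sum; apply: eq_bigr => p _.
by rewrite linearZZ t_lift uncrdC.
Qed.

Let sec_hom i v : hrow dA i v -> gpart i (sec v).
Proof.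
move=> /hrowP hv; apply: gpart_sum => p _.
rewrite -(subrK (dA p) i); apply: gpartZ => //.
by apply: degR_yR_poly => b /hv <-; rewrite addrAC subrr sub0r.
Qed.

Let ret_ex e : exists b, einj E b = e - sec (cA (eproj E e)).
Proof.
have /eexact[b ->] : eproj E (e - sec (cA (eproj E e))) = 0.
  by rewrite linearB eproj_sec crdK subrr.
by exists b.
Qed.

Let ret e : B := projT1 (cid (ret_ex e)).

Let retE e : einj E (ret e) = e - sec (cA (eproj E e)).
Proof. exact: projT2 (cid (ret_ex e)). Qed.

Let ret_sec e : e = einj E (ret e) + sec (cA (eproj E e)).
Proof. by rewrite retE subrK. Qed.

Let retD u v : ret (u + v) = ret u + ret v.
Proof.
apply: (@einj_inj _ _ _ _ E).
by rewrite linearD !retE linearD crdD secD opprD addrACA.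
Qed.

Let retC p u : ret (yR_poly k p *: u) = yR_poly k p *: ret u.
Proof.
apply: (@einj_inj _ _ _ _ E).
by rewrite linearZZ !retE linearZZ crdC secC scalerBr.
Qed.

Let ret_inj b : ret (einj E b) = b.
Proof. by apply: (@einj_inj _ _ _ _ E); rewrite retE eproj_inj crd0 sec0 subr0. Qed.

Let ret_hom i e : gpart i e -> gpart i (ret e).
Proof.
move=> he; apply: (@einj_reflects_hom E); rewrite retE.
apply: gpartD => //; apply: gpartN; apply: sec_hom.
by apply/crd_hom; apply: eproj_hom.
Qed.

(** Row [p] measures how far [x t_p] is from the section of its own image: this is the obstruction
    to [sec] being [R]-linear. *)
Let phi : 'M[P]_n := \matrix_p cB (ret (xR *: t p)).

Let ret0 : ret 0 = 0.
Proof. by rewrite -(linear0 (einj E)) ret_inj. Qed.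

Let ret_sum (J : finType) (u : J -> E) : ret (\sum_j u j) = \sum_j ret (u j).
Proof. exact: (big_morph _ retD ret0). Qed.

Let ret_secX v : cB (ret (xR *: sec v)) = v *m phi.
Proof.
rewrite /sec scaler_sumr ret_sum crd_sum [RHS]mulmx_sum_row; apply: eq_bigr => p _.
by rewrite scalerA mulrC -scalerA retC crdC rowK.
Qed.

Let cE (e : E) : 'rV[P]_(n + n) := row_mx (cB (ret e)) (cA (eproj E e)).
Let uE (w : 'rV[P]_(n + n)) : E := einj E (uncrd cB (lsubmx w)) + sec (rsubmx w).

Lemma section_chart : {psi & chart E psi}.
Proof.
exists phi.
unshelve refine (@Chart E phi (@Coords F k E _ _ _ cE uE _ _ _ _ _ _) _ _).
- by move=> u v; rewrite /cE retD linearD !crdD add_row_mx.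
- by move=> p u; rewrite /cE retC linearZZ !crdC scale_row_mx.
- move=> u; rewrite /cE /chart_mx mul_row_block mulmx0 add0r linearZZ crdX.
  (* Split [u] into its part in [B] and a section: [ret] commutes with [x] on the first, and the
     second contributes a product with [phi]. *)
  congr row_mx; rewrite {1}(ret_sec u) scalerDr retD crdD ret_secX.
  by rewrite -linearZZ ret_inj crdX.
- by move=> e; rewrite /uE /cE row_mxKl row_mxKr crdK -ret_sec.
- move=> w; rewrite /uE /cE retD ret_inj linearD eproj_inj eproj_sec add0r.
  rewrite uncrdK crdD uncrdK.
  have -> : ret (sec (rsubmx w)) = 0.
    apply: (@einj_inj _ _ _ _ E).
    by rewrite retE eproj_sec uncrdK subrr linear0.
  by rewrite crd0 addr0 hsubmxK.
- move=> i e; rewrite /cE; split=> [he|/hrow_row_mx[hb ha]].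
    apply/(hrow_row_mx dB dA); split; first exact/(crd_hom cB)/ret_hom.
    exact/(crd_hom cA)/eproj_hom.
  rewrite (ret_sec e); apply: gpartD; last exact: sec_hom.
  by apply/einj_hom/(crd_hom cB).
- by move=> b; rewrite /= /cE ret_inj eproj_inj crd0.
- by move=> e; rewrite /= /cE row_mxKr.
Qed.

End ChartExists.

(** Any choice of homogeneous lifts of the basis of [A] gives a chart; by [ext_equivP] below, two
    charts of one extension differ by a coboundary. *)
Lemma chart_exists (E : extension A B) : exists phi, inhabited (chart E phi).
Proof.
have /choice[t ht] : forall p : 'I_n, exists e : E,
    gpart (dA p) e /\ eproj E e = uncrd cA (delta_mx 0 p).
  move=> p; have [|e he Ee] := @eproj_lift_hom E (dA p) (uncrd cA (delta_mx 0 p)).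
    by apply/uncrd_hom/hrow_delta.
  by exists e.
have [phi c] := @section_chart E t (fun p => (ht p).1) (fun p => (ht p).2).
by exists phi.
Qed.

End Charts.

Lemma truncR_linear (F : fieldType) (k : nat) (U V : lmodType (truncR F k))
    (f : U -> V) :
  (forall u v, f (u + v) = f u + f v) ->
  (forall p u, f (yR_poly k p *: u) = yR_poly k p *: f u) ->
  (forall u, f (xR *: u) = xR *: f u) -> linear f.
Proof.
move=> fD fC fX r u v; rewrite fD; congr (_ + _).
elim/truncR_ind: r u => [//|r s IHr IHs|r IH] u.
  by rewrite !scalerDl fD IHr IHs.
by rewrite -!scalerA IH fX.
Qed.

Lemma addr_cancel_mid (V : zmodType) (a b c e : V) :
  a + e + (b + c - e) = a + b + c.
Proof. by rewrite -addrA (addrC e) subrK addrA. Qed.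

Section Submatrix.
Variables (K : nzRingType) (m n1 n2 : nat).
Implicit Types M N : 'M[K]_(m, n1 + n2).

Lemma lsubmxD M N : lsubmx (M + N) = lsubmx M + lsubmx N.
Proof. by apply/matrixP => i j; rewrite !mxE. Qed.

Lemma rsubmxD M N : rsubmx (M + N) = rsubmx M + rsubmx N.
Proof. by apply/matrixP => i j; rewrite !mxE. Qed.

Lemma lsubmxZ a M : lsubmx (a *: M) = a *: lsubmx M.
Proof. by apply/matrixP => i j; rewrite !mxE. Qed.

Lemma rsubmxZ a M : rsubmx (a *: M) = a *: rsubmx M.
Proof. by apply/matrixP => i j; rewrite !mxE. Qed.

End Submatrix.

(** * Equivalence, scalar action and Baer sum in terms of the block [phi] *)

Section ChartRelations.
Variables (F : fieldType) (k n : nat).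
Local Notation P := {poly F}.
Local Notation R := (truncR F k).
Local Notation gmod := (gmod F k).
Variables (A B : gmod) (dA dB : 'I_n -> int) (XA XB : 'M[P]_n).
Variables (cA : coords A dA XA) (cB : coords B dB XB).

Section OneChart.
Variables (E : extension A B) (phi : 'M[P]_n) (c : chart cA cB E phi).

Definition chart_sec (a : 'rV[P]_n) : E := uncrd c (row_mx 0 a).

Lemma crd_chart_sec a : c (chart_sec a) = row_mx 0 a.
Proof. exact: uncrdK. Qed.

Lemma chart_secD a b : chart_sec (a + b) = chart_sec a + chart_sec b.
Proof. by rewrite /chart_sec -uncrdD add_row_mx addr0. Qed.

Lemma chart_secC p a : chart_sec (p *: a) = yR_poly k p *: chart_sec a.
Proof. by rewrite /chart_sec -uncrdC scale_row_mx scaler0. Qed.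

Lemma chart_secX a : xR *: chart_sec a =
  einj E (uncrd cB (a *m phi)) + chart_sec (a *m XA).
Proof.
apply: (crd_inj c); rewrite crdX crdD chart_inj !crd_chart_sec uncrdK.
by rewrite mul_row_block !mul0mx !add0r add_row_mx addr0 add0r.
Qed.

Lemma eproj_chart_sec a : eproj E (chart_sec a) = uncrd cA a.
Proof. by apply: (crd_inj cA); rewrite -(chart_proj c) crd_chart_sec row_mxKr uncrdK. Qed.

Lemma chart_sec_hom i a : hrow dA i a -> gpart i (chart_sec a).
Proof. by move=> ha; apply/uncrd_hom/(hrow_row_mx dB dA); split=> //; apply: hmx0. Qed.

Lemma chart_lsubX e : lsubmx (c (xR *: e)) =
  lsubmx (c e) *m XB + rsubmx (c e) *m phi.
Proof. by rewrite crdX -{1}(hsubmxK (c e)) mul_row_block row_mxKl. Qed.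

Lemma chart_rsubX e : rsubmx (c (xR *: e)) = rsubmx (c e) *m XA.
Proof. by rewrite !chart_proj linearZZ crdX. Qed.

End OneChart.

Lemma rV_additive_mx (g : 'rV[P]_n -> 'rV[P]_n) :
  (forall u v, g (u + v) = g u + g v) -> (forall p u, g (p *: u) = p *: g u) ->
  exists h, forall v, g v = v *m h.
Proof.
move=> gD gC; exists (\matrix_p g (delta_mx 0 p)) => v.
have g0 : g 0 = 0 by have := gC 0 0; rewrite !scale0r.
rewrite {1}[v]row_sum_delta (big_morph g gD g0) mulmx_sum_row.
by apply: eq_bigr => p _; rewrite gC rowK.
Qed.

Lemma hmx0_rowP (h : 'M[P]_n) :
  (forall p, hrow dB (dA p) (delta_mx 0 p *m h)) -> hmx dA dB 0 h.
Proof. by move=> hh; apply/hmx_row => p; rewrite addr0 rowE. Qed.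

Variables (E E' E'' : extension A B) (phi phi' phi'' : 'M[P]_n).
Variables (c : chart cA cB E phi) (c' : chart cA cB E' phi').
Variables (c'' : chart cA cB E'' phi'').

(** In charts, a map over [A] restricting to [l] on [B] sends [(b, a)] to [(l b + a h, a)].
    Commuting with [x] on [(0, a)] reads [l a phi + a XA h = a h XB + a phi']. *)
Lemma ext_scaleP (l : F) : ext_scale l E E' <->
  exists h, hmx dA dB 0 h /\ phi' = l%:P *: phi + XA *m h - h *m XB.
Proof.
split=> [[f [f_hom [f_inj f_proj]]]|[h [h_hom h_eq]]].
- have [h hh] : exists h, forall a, lsubmx (c' (f (chart_sec c a))) = a *m h.
    apply: rV_additive_mx => [u v|p u].
      by rewrite chart_secD linearD crdD lsubmxD.
    by rewrite chart_secC linearZZ crdC lsubmxZ.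
  have hc a : c' (f (chart_sec c a)) = row_mx (a *m h) a.
    by rewrite -[LHS]hsubmxK hh chart_proj f_proj eproj_chart_sec uncrdK.
  exists h; split.
    apply: hmx0_rowP => p; rewrite -hh.
    have /(crd_hom c') : gpart (dA p) (f (chart_sec c (delta_mx 0 p))).
      by apply/f_hom/chart_sec_hom/hrow_delta.
    by rewrite -{1}[c' _]hsubmxK => /(hrow_row_mx dB dA)[].
  apply/row_matrixP => p; rewrite !rowE; set a := delta_mx 0 p.
  (* Apply [f] to the formula for [x] on the section and compare the coordinates in [B]. *)
  have := congr1 (fun e => lsubmx (c' (f e))) (chart_secX c a).
  rewrite linearZZ chart_lsubX hc row_mxKl row_mxKr linearD crdD f_inj.
  rewrite chart_inj hc add_row_mx row_mxKl [cstR l](_ : _ = yR_poly k l%:P) //.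
  rewrite crdC uncrdK => /(canRL (addKr _)) ->.
  by rewrite mulmxBr mulmxDr -scalemxAr !mulmxA addrC.
pose f e := uncrd c' (row_mx (l%:P *: lsubmx (c e) + rsubmx (c e) *m h) (rsubmx (c e))).
have cf e : c' (f e) =
    row_mx (l%:P *: lsubmx (c e) + rsubmx (c e) *m h) (rsubmx (c e)).
  exact: uncrdK.
have f_lin : linear f.
  apply: truncR_linear => [u v|p u|u]; apply: (crd_inj c').
  - rewrite crdD !cf crdD lsubmxD rsubmxD scalerDr mulmxDl add_row_mx.
    by rewrite addrACA.
  - rewrite crdC !cf crdC lsubmxZ rsubmxZ -scalemxAl scale_row_mx scalerDr !scalerA.
    by rewrite mulrC.
  rewrite crdX !cf chart_lsubX chart_rsubX mul_row_block mulmx0 add0r.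
  congr row_mx; rewrite h_eq mulmxBr !mulmxDr mulmxDl -scalemxAr -!scalemxAl.
  by rewrite scalerDr !mulmxA addr_cancel_mid.
exists (mk_linear f_lin); split; last split.
- move=> i e /(crd_hom c); rewrite -[c e]hsubmxK => /(hrow_row_mx dB dA)[hl hr].
  apply/(crd_hom c'); rewrite /= cf; apply/(hrow_row_mx dB dA); split=> //.
  apply: hmxD; first exact: hmxZ.
  by rewrite -(addr0 i); apply: hmx_mul hr h_hom.
- move=> b; apply: (crd_inj c'); rewrite /= cf !chart_inj row_mxKl row_mxKr mul0mx addr0.
  by rewrite [cstR l](_ : _ = yR_poly k l%:P) // crdC.
- move=> e; apply: (crd_inj cA); rewrite -(chart_proj c') -(chart_proj c).
  by rewrite /= cf row_mxKr.
Qed.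

Lemma ext_equivP : ext_equiv E E' <->
  exists h, hmx dA dB 0 h /\ phi' = phi + XA *m h - h *m XB.
Proof.
have <- : ext_scale 1 E E' <-> ext_equiv E E'.
  have E1 : cstR 1 = 1 :> R by rewrite [LHS](rmorph1 (@yR_poly F k)).
  by split=> -[f [? [f_inj ?]]]; exists f; split=> //; split=> // b;
    move: (f_inj b); rewrite E1 scale1r.
by rewrite ext_scaleP polyC1; split=> -[h]; rewrite scale1r => hh; exists h.
Qed.

(** Applying [s] to the paired sections of [E] and [E'] gives a section of [E''] with block
    [phi + phi']. Its difference [h] from the section of [c''] accounts for the coboundary. *)
Lemma baer_sumP : baer_sum E E' E'' <->
  exists h, hmx dA dB 0 h /\ phi'' = phi + phi' + XA *m h - h *m XB.
Proof.
split=> [[s [s_lin [s_hom [s_proj s_inj]]]]|[h [h_hom h_eq]]].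
- pose t a := s (chart_sec c a) (chart_sec c' a).
  have cmp a : eproj E (chart_sec c a) = eproj E' (chart_sec c' a).
    by rewrite !eproj_chart_sec.
  have s0 : s 0 0 = 0.
    have := s_inj 0 0; by rewrite addr0 !linear0.
  have sZ r e e' : eproj E e = eproj E' e' -> s (r *: e) (r *: e') = r *: s e e'.
    move=> ee; have := s_lin r e e' 0 0 ee; rewrite !addr0 !linear0 s0 addr0.
    by apply.
  have sD e1 e1' e2 e2' : eproj E e1 = eproj E' e1' -> eproj E e2 = eproj E' e2' ->
      s (e1 + e2) (e1' + e2') = s e1 e1' + s e2 e2'.
    by move=> h1 h2; have := s_lin 1 _ _ _ _ h1 h2; rewrite !scale1r.
  have [h hh] : exists h, forall a, lsubmx (c'' (t a)) = a *m h.
    apply: rV_additive_mx => [u v|p u].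
      by rewrite /t !chart_secD sD // crdD lsubmxD.
    by rewrite /t !chart_secC sZ // crdC lsubmxZ.
  have hc a : c'' (t a) = row_mx (a *m h) a.
    by rewrite -[LHS]hsubmxK hh chart_proj s_proj // eproj_chart_sec uncrdK.
  exists h; split.
    apply: hmx0_rowP => p; rewrite -hh.
    have /(crd_hom c'') : gpart (dA p) (t (delta_mx 0 p)).
      by apply: s_hom => //; apply/chart_sec_hom/hrow_delta.
    by rewrite -{1}[c'' _]hsubmxK => /(hrow_row_mx dB dA)[].
  apply/row_matrixP => p; rewrite !rowE; set a := delta_mx 0 p.
  have : lsubmx (c'' (xR *: t a)) =
      lsubmx (c'' (s (xR *: chart_sec c a) (xR *: chart_sec c' a))).
    by rewrite sZ.
  rewrite chart_lsubX hc row_mxKl row_mxKr !chart_secX sD ?eproj_inj // s_inj.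
  rewrite crdD hc chart_inj crdD !uncrdK add_row_mx row_mxKl.
  move=> /(canRL (addKr _)) ->.
  by rewrite mulmxBr !mulmxDr !mulmxA addrC.
pose s e e' := uncrd c'' (row_mx
  (lsubmx (c e) + lsubmx (c' e') + rsubmx (c e) *m h) (rsubmx (c e))).
have cs e e' : c'' (s e e') =
    row_mx (lsubmx (c e) + lsubmx (c' e') + rsubmx (c e) *m h) (rsubmx (c e)).
  exact: uncrdK.
have sD e1 e1' e2 e2' : s (e1 + e2) (e1' + e2') = s e1 e1' + s e2 e2'.
  apply: (crd_inj c''); rewrite crdD !cs !crdD !lsubmxD rsubmxD mulmxDl add_row_mx.
  by congr row_mx; rewrite [RHS]addrACA; congr (_ + _); rewrite addrACA.
have sZ r e e' : eproj E e = eproj E' e' -> s (r *: e) (r *: e') = r *: s e e'.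
  elim/truncR_ind: r e e' => [p|r1 r2 IH1 IH2|r IH] e e' ee.
  - apply: (crd_inj c''); rewrite crdC !cs !crdC !lsubmxZ rsubmxZ -scalemxAl.
    by rewrite scale_row_mx !scalerDr.
  - by rewrite !scalerDl sD IH1 // IH2.
  rewrite -!scalerA IH; last by rewrite !linearZZ ee.
  congr (_ *: _); apply: (crd_inj c'').
  (* The fibre product condition enters here: [x e'] brings in [phi'] applied to the [A] coordinates
     of [e'], whereas [s] keeps those of [e]. *)
  have ree : rsubmx (c e) = rsubmx (c' e') by rewrite !chart_proj ee.
  rewrite crdX !cs !chart_lsubX chart_rsubX mul_row_block mulmx0 add0r -ree.
  congr row_mx; rewrite h_eq mulmxBr !mulmxDr !mulmxDl !mulmxA.
  by rewrite addr_cancel_mid [in LHS]addrACA.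
exists s; split; last split; last split.
- by move=> r e1 e1' e2 e2' h1 h2; rewrite sD sZ.
- move=> i e e' ee /(crd_hom c); rewrite -[c e]hsubmxK => /(hrow_row_mx dB dA)[hl hr].
  move=> /(crd_hom c'); rewrite -[c' e']hsubmxK => /(hrow_row_mx dB dA)[hl' hr'].
  apply/(crd_hom c''); rewrite cs; apply/(hrow_row_mx dB dA); split=> //.
  apply: hmxD; first exact: hmxD.
  by rewrite -(addr0 i); apply: hmx_mul hr h_hom.
- by move=> e e' ee; apply: (crd_inj cA); rewrite -(chart_proj c'') -(chart_proj c) cs row_mxKr.
- move=> b b'; apply: (crd_inj c''); rewrite cs !chart_inj !row_mxKl row_mxKr.
  by rewrite mul0mx addr0 crdD.
Qed.

End ChartRelations.

(** * Nilpotent homogeneous block matrices realized as extensions *)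

Section Realization.
Variables (F : fieldType) (k n : nat).
Local Notation P := {poly F}.
Variables (A B : gmod F k) (dA dB : 'I_n.+1 -> int) (XA XB : 'M[P]_n.+1).
Variables (cA : coords A dA XA) (cB : coords B dB XB) (phi : 'M[P]_n.+1).

Hypothesis phi_hom : hmx dA dB 1 phi.
(** The ascription shows the size [n.+1 + n.+1] as a successor, to which it is convertible, so that
    the ring structure on square matrices applies. *)
Hypothesis phi_nil : (chart_mx XA XB phi : 'M_((n + n.+1).+1)) ^+ k = 0.

Lemma chart_mx_hmx : hmx (chart_deg dA dB) (chart_deg dA dB) 1 (chart_mx XA XB phi).
Proof.
apply/(hmx_block dB dA); split=> //; first exact: (coords_hmx cB).
  exact: hmx0.
exact: (coords_hmx cA).
Qed.

Lemma chart_realized : exists E : extension A B, inhabited (chart cA cB E phi).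
Proof.
pose M := gmxmod phi_nil (chart_mx_hmx : @hmx _ (n + n.+1).+1 (n + n.+1).+1 _ _ _ _).
have c : coords M (chart_deg dA dB) (chart_mx XA XB phi).
  exact: gmxmod_coords.
pose i (b : B) : M := uncrd c (row_mx (cB b) 0).
pose j (e : M) : A := uncrd cA (rsubmx (c e)).
have ci b : c (i b) = row_mx (cB b) 0 by apply: uncrdK.
have cj e : cA (j e) = rsubmx (c e) by apply: uncrdK.
have i_lin : linear i.
  apply: truncR_linear => [u v|p u|u]; apply: (crd_inj c).
  - by rewrite crdD !ci crdD add_row_mx addr0.
  - by rewrite crdC !ci crdC scale_row_mx scaler0.
  by rewrite crdX !ci crdX mul_row_block !mul0mx mulmx0 !addr0.
have j_lin : linear j.
  apply: truncR_linear => [u v|p u|u]; apply: (crd_inj cA).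
  - by rewrite crdD !cj crdD rsubmxD.
  - by rewrite crdC !cj crdC rsubmxZ.
  by rewrite crdX !cj crdX -{1}(hsubmxK (c u)) mul_row_block row_mxKr mulmx0 add0r.
pose I := mk_linear i_lin; pose J := mk_linear j_lin.
have cI b : c (I b) = row_mx (cB b) 0 by apply: ci.
have cJ e : cA (J e) = rsubmx (c e) by apply: cj.
have I_hom : homogeneous I.
  move=> d b /(crd_hom cB) hb; apply/(crd_hom c); rewrite cI.
  by apply/(hrow_row_mx dB dA); split=> //; apply: hmx0.
have J_hom : homogeneous J.
  move=> d e /(crd_hom c); rewrite -[c e]hsubmxK => /(hrow_row_mx dB dA)[_ he].
  by apply/(crd_hom cA); rewrite cJ.
have I_inj : injective I.
  move=> b b' /(congr1 c); rewrite !cI => /eq_row_mx[/(crd_inj cB)//].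
have J_surj a : exists e, J e = a.
  exists (uncrd c (row_mx 0 (cA a))); apply: (crd_inj cA).
  by rewrite cJ uncrdK row_mxKr.
have IJ_exact e : J e = 0 <-> exists b, e = I b.
  split=> [/(congr1 cA)|[b ->]]; last first.
    by apply: (crd_inj cA); rewrite cJ cI row_mxKr crd0.
  rewrite cJ crd0 => e0; exists (uncrd cB (lsubmx (c e))).
  by apply: (crd_inj c); rewrite cI uncrdK -e0 hsubmxK.
exists (@Extension F k A B M I J (gmxmod_MCM _ _) I_hom J_hom I_inj J_surj IJ_exact).
by constructor; exists c => [b|e]; [exact: cI | exact/esym/cJ].
Qed.

End Realization.

(** * Extension classes as cocycles modulo coboundaries *)

Section Dehomogenization.
Variable F : fieldType.
Local Notation P := {poly F}.

Definition dehomog m n (M : 'M[P]_(m, n)) : 'M[F]_(m, n) :=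
  map_mx (horner_eval 1) M.

(** Under [hsupp] the exponent is nonnegative at every nonzero entry, so [absz] changes nothing
    there. *)
Definition homog m n (d : 'I_m -> int) (d' : 'I_n -> int) (s : int)
    (N : 'M[F]_(m, n)) : 'M[P]_(m, n) :=
  \matrix_(p, q) (N p q *: 'X^(absz (d' q - d p - s)%R)).

Definition hsupp m n (d : 'I_m -> int) (d' : 'I_n -> int) (s : int)
    (N : 'M[F]_(m, n)) : Prop := forall p q, N p q != 0 -> d p + s <= d' q.

Section Basic.
Variables (m n : nat) (d : 'I_m -> int) (d' : 'I_n -> int) (s : int).

Lemma homogK (N : 'M[F]_(m, n)) : dehomog (homog d d' s N) = N.
Proof.
apply/matrixP => p q; rewrite !mxE /horner_eval hornerZ hornerXn expr1n.
by rewrite mulr1.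
Qed.

Lemma homog_hmx N : hsupp d d' s N -> hmx d d' s (homog d d' s N).
Proof.
move=> hN p q b; rewrite mxE coefZ coefXn.
have [->|/hN] := eqVneq (N p q) 0; first by rewrite mul0r eqxx.
case: (eqVneq b _) => [->|_]; last by rewrite mulr0 eqxx.
lia.
Qed.

Lemma hmx_dehomog_supp M : hmx d d' s M -> hsupp d d' s (dehomog M).
Proof.
move=> hM p q; rewrite mxE => ne.
have [b] : exists b, (M p q)`_b != 0.
  exists (size (M p q)).-1; rewrite lead_coef_eq0.
  by apply: contraNneq ne => ->; rewrite /horner_eval horner0.
by move=> /hM; lia.
Qed.

(** A homogeneous entry is a scalar times one power of [y] fixed by the degrees, so its value at
    [y = 1] recovers it. *)
Lemma dehomogK M : hmx d d' s M -> homog d d' s (dehomog M) = M.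
Proof.
move=> hM; apply/matrixP => p q; rewrite !mxE.
have EM : M p q = (M p q)`_(absz (d' q - d p - s)%R) *: 'X^(absz (d' q - d p - s)%R).
  apply/polyP => b; rewrite coefZ coefXn.
  have [->|ne] := eqVneq b; first by rewrite mulr1.
  rewrite mulr0; apply/eqP; apply: contraNT ne => /hM; lia.
by rewrite [in LHS]EM /horner_eval hornerZ hornerXn expr1n mulr1.
Qed.

Lemma dehomog_inj M M' : hmx d d' s M -> hmx d d' s M' ->
  dehomog M = dehomog M' -> M = M'.
Proof. by move=> hM hM' E; rewrite -(dehomogK hM) E dehomogK. Qed.

End Basic.

Lemma dehomogD m n (M N : 'M[P]_(m, n)) : dehomog (M + N) = dehomog M + dehomog N.
Proof. exact: map_mxD. Qed.

Lemma dehomogB m n (M N : 'M[P]_(m, n)) : dehomog (M - N) = dehomog M - dehomog N.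
Proof. exact: map_mxB. Qed.

Lemma dehomogZ m n a (M : 'M[P]_(m, n)) : dehomog (a%:P *: M) = a *: dehomog M.
Proof. by apply/matrixP => i j; rewrite !mxE /horner_eval hornerM hornerC. Qed.

Lemma dehomogM m n l (M : 'M[P]_(m, n)) (N : 'M[P]_(n, l)) :
  dehomog (M *m N) = dehomog M *m dehomog N.
Proof. exact: map_mxM. Qed.

Lemma dehomogX n (M : 'M[P]_n.+1) i : dehomog (M ^+ i) = dehomog M ^+ i.
Proof.
elim: i => [|i IH]; first by rewrite !expr0; exact: map_mx1.
by rewrite !exprS -IH; exact: dehomogM.
Qed.

End Dehomogenization.

(** The map [p] has kernel [B], so the image of [Z] is a copy of the quotient of [Z] by [Z :&: B];
    [theta] reads coordinates of [p u] in a basis of that image. *)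
Lemma quotient_coordinates (K : fieldType) (V : vectType K) (Z B : {vspace V}) :
  exists theta : {linear V -> 'rV[K]_(\dim Z - \dim (Z :&: B))},
    (forall v, exists2 u, u \in Z & theta u = v) /\
    (forall u, u \in Z -> theta u = 0 <-> u \in B).
Proof.
pose p : 'End(V) := (\1 - projv B)%VF.
have pE u : p u = u - projv B u by rewrite add_lfunE opp_lfunE id_lfunE.
have p0 u : (p u == 0) = (u \in B).
  rewrite pE subr_eq0; apply/eqP/idP => [->|/projv_id->//].
  exact: memv_proj.
have dimW : \dim (p @: Z) = (\dim Z - \dim (Z :&: B))%N.
  rewrite -(limg_ker_dim p Z); suff -> : lker p = B by rewrite addKn.
  by apply/vspaceP => u; rewrite memv_ker p0.
rewrite -dimW; set W := (p @: Z)%VS.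
pose th u : 'rV[K]_(\dim W) := \row_i coord (vbasis W) i (p u).
have th_lin : linear th.
  by move=> a u v; apply/rowP => i; rewrite !mxE !linearP.
exists (mk_linear th_lin); split.
  move=> v; have : \sum_i v 0 i *: (vbasis W)`_i \in W.
    by rewrite memv_suml // => i _; rewrite memvZ // vbasis_mem // mem_nth ?size_tuple.
  move=> /memv_imgP[u uZ Eu]; exists u => //=; apply/rowP => i; rewrite mxE -Eu.
  by rewrite coord_sum_free // (basis_free (vbasisP W)).
move=> u uZ; rewrite -p0 /=; split=> [th0|/eqP pu0]; last first.
  by apply/rowP => i; rewrite !mxE pu0 linear0.
rewrite (coord_vbasis (memv_img p uZ)) big1 // => i _.
by have /rowP/(_ i) := th0; rewrite !mxE => ->; rewrite scale0r.
Qed.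

Section ExtDimension.
Variables (F : fieldType) (k n : nat).
Local Notation P := {poly F}.
Variables (A B : gmod F k) (dA dB : 'I_n.+1 -> int) (XA XB : 'M[P]_n.+1).
Variables (cA : coords A dA XA) (cB : coords B dB XB).
Hypothesis k_gt0 : (0 < k)%N.

Local Notation chart_mxF N :=
  (block_mx (dehomog XB) 0 N (dehomog XA) : 'M_((n + n.+1).+1)).

Lemma dehomog_chart_mx phi : dehomog (chart_mx XA XB phi) =
  block_mx (dehomog XB) 0 (dehomog phi) (dehomog XA).
Proof. by rewrite /dehomog map_block_mx map_mx0. Qed.

(** Powers of a homogeneous matrix are homogeneous, and setting [y = 1] is injective on homogeneous
    matrices of a given degree. *)
Lemma chart_nilP phi : hmx dA dB 1 phi ->
  (chart_mx XA XB phi : 'M_((n + n.+1).+1)) ^+ k = 0 <->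
  chart_mxF (dehomog phi) ^+ k = 0.
Proof.
move=> hphi; rewrite -dehomog_chart_mx -dehomogX; split=> [->|].
  exact: map_mx0.
have h0 := @hmx0 F _ _ (chart_deg dA dB) (chart_deg dA dB) k%:Z.
move=> E; apply: (dehomog_inj _ h0); last by rewrite E [RHS]map_mx0.
by apply: hmx_exp; apply: (chart_mx_hmx cA cB).
Qed.

Lemma coboundaryP phi psi : hmx dA dB 1 phi -> hmx dA dB 1 psi ->
  (exists h, hmx dA dB 0 h /\ phi = psi + XA *m h - h *m XB) <->
  (exists H, hsupp dA dB 0 H /\
     dehomog phi - dehomog psi = dehomog XA *m H - H *m dehomog XB).
Proof.
move=> hphi hpsi; split=> [[h [hh ->]]|[H [hH E]]].
  exists (dehomog h); split; first exact: hmx_dehomog_supp.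
  by rewrite dehomogB dehomogD !dehomogM addrAC [dehomog psi + _]addrC addrK.
exists (homog dA dB 0 H); have hh := homog_hmx hH; split=> //.
have hXA := coords_hmx cA; have hXB := coords_hmx cB.
apply: (dehomog_inj hphi).
  apply: hmxD; first apply: hmxD => //.
    by rewrite -(addr0 1); apply: hmx_mul hXA hh.
  by apply: hmxN; rewrite -(add0r 1); apply: hmx_mul hh hXB.
rewrite dehomogB dehomogD !dehomogM homogK -addrA -E.
by rewrite addrCA subrr addr0.
Qed.

Variables Z D : {vspace 'M[F]_n.+1}.
Hypothesis ZP : forall N, N \in Z <->
  hsupp dA dB 1 N /\ chart_mxF N ^+ k = 0.
Hypothesis DP : forall N, N \in D <->
  exists H, hsupp dA dB 0 H /\ N = dehomog XA *m H - H *m dehomog XB.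

Lemma dim_Ext1_cocycles : dim_Ext1 A B (\dim Z - \dim (Z :&: D)).
Proof.
have [theta [th_surj th0]] := quotient_coordinates Z D.
pose phi E := projT1 (cid (chart_exists cA cB E)).
have phiP E : inhabited (chart cA cB E (phi E)).
  exact: projT2 (cid (chart_exists cA cB E)).
have phiX E : hmx dA dB 1 (phi E) by have [c] := phiP E; apply: chart_hmx c.
have phiZ E : dehomog (phi E) \in Z.
  apply/ZP; split; first exact: hmx_dehomog_supp (phiX E).
  by apply/chart_nilP => //; have [c] := phiP E; apply: (coords_nil c).
have thE u v : u \in Z -> v \in Z -> theta u = theta v <->
    exists H, hsupp dA dB 0 H /\ u - v = dehomog XA *m H - H *m dehomog XB.
  move=> uZ vZ; rewrite -DP -th0 ?rpredB // linearB.
  by split=> [->|/eqP]; rewrite ?subrr // subr_eq0 => /eqP.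
(* By [thE], two values agree exactly when the blocks of the chosen charts differ by a
   coboundary. *)
exists (fun E => theta (dehomog (phi E))); split; last split; last split.
- move=> v; have [N NZ <-] := th_surj v; have [hN N_nil] := (ZP N).1 NZ.
  have hpsi := homog_hmx hN.
  have psi_nil : (chart_mx XA XB (homog dA dB 1 N) : 'M_((n + n.+1).+1)) ^+ k = 0.
    by apply/chart_nilP => //; rewrite homogK.
  have [E [c]] := chart_realized cA cB hpsi psi_nil; exists E.
  have [c'] := phiP E.
  apply/thE => //; rewrite -{1}(homogK dA dB 1 N).
  apply/coboundaryP => //; apply/(ext_equivP c c').
  (* The chart chosen for [E] need not be [c]; the identity of [E] shows that the two blocks differ
     by a coboundary. *)
  exists (mk_linear (f := id) (fun a u v => erefl)); split=> //.
- move=> E E'; have [c] := phiP E; have [c'] := phiP E'.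
  rewrite (ext_equivP c c') coboundaryP // -thE //; split=> ->//.
- move=> E E' E''; have [c] := phiP E; have [c'] := phiP E'; have [c''] := phiP E''.
  rewrite (baer_sumP c c' c'') coboundaryP ?dehomogD; last exact: hmxD.
    by rewrite -thE ?rpredD // linearD.
  exact: phiX.
move=> a E E'; have [c] := phiP E; have [c'] := phiP E'.
rewrite (ext_scaleP c c') coboundaryP ?dehomogZ; last exact: hmxZ.
  by rewrite -thE ?rpredZ // linearZZ.
exact: phiX.
Qed.

End ExtDimension.

(** * The ideals I(l) *)

Definition shift_mx (K : nzRingType) n : 'M[K]_n := \matrix_(p, q) (q == p.+1 :> nat)%:R.

Section KSubset.
Variables (k : nat) (l : {fset int}).
Hypothesis hl : #|` l|%fset = k.

Definition ell (p : 'I_k) : int := elt l p.+1.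

Let s := sort <=%R (enum_fset l).

Lemma size_ell : size s = k.
Proof. by rewrite size_sort. Qed.

Lemma ell_lt (p q : 'I_k) : (p < q)%N -> ell p < ell q.
Proof.
move=> pq; rewrite /ell /elt /=.
have /(sorted_ltn_nth lt_trans 0) : sorted <%R s by rewrite sort_lt_sorted fset_uniq.
by apply; rewrite // inE size_ell.
Qed.

(** Consecutive elements differ by at least 1; this makes the exponents [expo] nonnegative. *)
Lemma ell_gap (p q : 'I_k) : (p <= q)%N -> ell p + (q%:Z - p%:Z) <= ell q.
Proof.
move=> pq; have [m Em] : exists m, (q = m + p :> nat)%N by exists (q - p)%N; rewrite subnK.
elim: m q pq Em => [|m IH] q pq Em.
  have -> : q = p by apply: val_inj.
  by rewrite subrr addr0.
have hq : (m + p < k)%N by rewrite (leq_trans _ (ltn_ord q)) // Em.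
have := IH (Ordinal hq) (leq_addl _ _) erefl.
have : ell (Ordinal hq) < ell q by apply: ell_lt; rewrite /= Em.
rewrite /= Em; lia.
Qed.

Lemma ell_mem (z : int) : (z \in l) = [exists p, ell p == z].
Proof.
have -> : (z \in l) = (z \in s) by rewrite mem_sort.
apply/idP/existsP => [zs|[p /eqP <-]]; last first.
  have := mem_nth (0 : int) (_ : (p < size s)%N); rewrite size_ell; exact.
have hz : (index z s < k)%N by rewrite -size_ell index_mem.
by exists (Ordinal hz); rewrite /ell /elt /= nth_index.
Qed.

Lemma ell_inj : injective ell.
Proof.
move=> p q E; apply: val_inj; case: (ltngtP p q) => // /ell_lt;
  by rewrite E ltxx.
Qed.

End KSubset.

(** * A homogeneous F[y]-basis of [Iell] and the matrix of [x] in it *)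

Section IdealCoordinates.
Variables (F : fieldType) (n : nat).
Local Notation k := n.+1.
Local Notation P := {poly F}.
Local Notation R := (truncR F k).
Variable l : {fset int}.
Hypothesis hl : #|` l|%fset = k.
Local Notation lam := (@ell k l).

(** The generator with [x]-power [p] is [x^p y^(e p)]; [expo] counts from the top power [x^n]
    downwards, hence [n - p]. *)
Let e (p : nat) : nat := absz (expo k l (n - p)%N).

Let eE (p : 'I_k) : (e p)%:Z = lam ord_max - lam p - (n - p)%N%:Z.
Proof.
have := ltn_ord p; rewrite ltnS => pn.
rewrite /e /expo /ell /= (_ : (k - (n - p))%N = p.+1); last by lia.
have := @ell_gap k l hl p ord_max pn; rewrite /ell /=; lia.
Qed.

Let e_anti (p q : 'I_k) : (p <= q)%N -> (e q <= e p)%N.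
Proof.
move=> pq; have := eE p; have := eE q; have := @ell_gap k l hl p q pq.
have := ltn_ord p; have := ltn_ord q; lia.
Qed.

Let gens : seq (nat * nat) :=
  [seq ((k - 1 - j)%N, absz (expo k l j)) | j <- iota 0 k].

Let size_gens : size gens = k. Proof. by rewrite size_map size_iota. Qed.

Let nth_gens (i : 'I_k) : nth (0%N, 0%N) gens i = (rev_ord i : nat, e (rev_ord i)).
Proof.
have := ltn_ord i; rewrite ltnS => hi.
rewrite (nth_map 0%N) ?size_iota // nth_iota // add0n /e /=.
by congr pair; [|congr absz; congr expo]; lia.
Qed.

Let T (v : 'rV[P]_k) : R := \sum_(a < k) yR_poly k (v 0 a) * (xR ^+ a * yR ^+ (e a)).

Lemma mono_xyE (p : P) (a b : nat) : yR_poly k p * (xR ^+ a * yR ^+ b) =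
  in_qpoly 'X^k ((p * 'X^b) *: 'X^a : {poly P}).
Proof.
by rewrite mono_xy yR_polyE -in_qpolyM mul_polyC scalerA.
Qed.

Let coefT v (a : 'I_k) : (T v : {poly P})`_a = v 0 a * 'X^(e a).
Proof.
rewrite /T; under eq_bigr => b _ do rewrite mono_xyE.
rewrite -(raddf_sum (in_qpoly ('X^k : {poly P}))).
rewrite red_take // coef_take_poly ltn_ord coef_sum (bigD1 a) //=.
rewrite coefZ coefXn eqxx mulr1 big1 ?addr0 // => b ba.
by rewrite coefZ coefXn eq_sym (negPf (ba : (b : nat) != a)) mulr0.
Qed.

Let coef_out (r : R) a : (k <= a)%N -> (r : {poly P})`_a = 0.
Proof.
by move=> ka; rewrite -(polyn_truncRK r) red_take // coef_take_poly ltnNge ka.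
Qed.

Let T_ideal v : (T v : R^o) \in mono_ideal_pred gens.
Proof.
apply/asboolP; exists (fun i => yR_poly k (v 0 (inord (n - i)%N))).
rewrite size_gens /T (reindex_inj rev_ord_inj) /=; apply: eq_bigr => i _.
rewrite nth_gens /mono /=; congr (yR_poly k (v 0 _) * _).
by apply: val_inj; rewrite /= inordK ?subSS // ltnS leq_subr.
Qed.

Let T_surj (r : R) : (r : R^o) \in mono_ideal_pred gens -> exists v, T v = r.
Proof.
move=> /asboolP[c Er].
(* A multiple of [x^p y^(e p)] reaches [x^a] only if [p <= a], and then [e a <= e p]. So the
   coefficient of [x^a] is divisible by [y^(e a)]. *)
have low (a : 'I_k) b : (b < e a)%N -> coefxy r a b = 0.
  move=> hb; rewrite Er coefxy_sum big1 // => i _.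
  move: (ltn_ord i); rewrite {2}size_gens => hi.
  rewrite (nth_gens (Ordinal hi)) coefxyM ltn_ord.
  rewrite big1 // => a' _; rewrite big1 // => b' _.
  rewrite [X in _ * X](_ : _ = 0) ?mulr0 // /mono mono_xy /coefxy red_take //.
  rewrite coef_take_poly [(_, _).1]/= [(_, _).2]/=; case: ifP => _; last by rewrite coef0.
  rewrite coefZ coefXn; case: eqP => [Ea|_]; last by rewrite mulr0 coef0.
  rewrite mulr1 coefXn; case: eqP => // Eb.
  have : (e a <= e (rev_ord (Ordinal hi)))%N.
    by apply: e_anti; rewrite /= -Ea leq_subr.
  by rewrite -Eb; lia.
exists (\row_a drop_poly (e a) (r : {poly P})`_a).
apply: val_inj; apply/polyP => a; rewrite /=.
case: (ltnP a k) => ha; last first.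
  by rewrite !coef_out.
rewrite (coefT _ (Ordinal ha)) mxE /=.
apply/polyP => b; rewrite coefMXn; case: ltnP => hb.
  by have := low (Ordinal ha) b hb; rewrite /coefxy /= => ->.
by rewrite coef_drop_poly subnK.
Qed.

Let T_inj : injective T.
Proof.
move=> u v E; apply/rowP => a.
have : u 0 a * 'X^(e a) = v 0 a * 'X^(e a) by rewrite -!coefT E.
by apply: mulIf; rewrite -size_poly_eq0 size_polyXn.
Qed.

Let TD u v : T (u + v) = T u + T v.
Proof.
by rewrite /T -big_split; apply: eq_bigr => a _; rewrite mxE rmorphD mulrDl.
Qed.

Let TC p v : T (p *: v) = yR_poly k p * T v.
Proof.
by rewrite /T mulr_sumr; apply: eq_bigr => a _; rewrite mxE rmorphM -mulrA.
Qed.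

Let TX v : T (v *m homog lam lam 1 (shift_mx F k)) = xR * T v.
Proof.
set X := homog _ _ _ _.
have -> : T (v *m X) = \sum_(a < k) \sum_p
    yR_poly k (v 0 p) * (yR_poly k (X p a) * (xR ^+ a * yR ^+ (e a))).
  apply: eq_bigr => a _; rewrite mxE rmorph_sum mulr_suml.
  by apply: eq_bigr => p _; rewrite rmorphM -mulrA.
rewrite exchange_big mulr_sumr; apply: eq_bigr => p _ /=.
rewrite -mulr_sumr [RHS]mulrCA; congr (_ * _); rewrite [RHS]mulrA -exprS {}/X.
(* For [p < n], [x] sends basis element [p] to [y^(e p - e p.+1)] times the next one, and this
   exponent is [lam p.+1 - lam p - 1]. For [p = n] the product contains [x^k = 0]. *)
have [pn|pn] := ltnP p n; last first.
  have -> : xR ^+ p.+1 = 0 :> R.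
    by rewrite (_ : p.+1 = k) -?in_qpolyXn ?redXk //; have := ltn_ord p; lia.
  rewrite mul0r big1 // => a _; rewrite !mxE (_ : (a == p.+1 :> nat) = false).
    by rewrite scale0r rmorph0 mul0r.
  by have := ltn_ord a; lia.
have hp : (p.+1 < k)%N by [].
rewrite (bigD1 (Ordinal hp)) //= big1 ?addr0 => [|a ap]; last first.
  rewrite !mxE (_ : (a == p.+1 :> nat) = false) ?scale0r ?rmorph0 ?mul0r //.
  by apply: contraNF ap => /eqP E; apply/eqP/val_inj.
rewrite !mxE eqxx scale1r rmorphXn /= mulrCA -exprD; congr (_ * _ ^+ _).
have := eE p; have := eE (Ordinal hp); have := @ell_gap k l hl p (Ordinal hp) (leqnSn p).
rewrite /=; lia.
Qed.

Let ideal := gmono_ideal F k gens.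
Let Tm v : ideal := MonoIdeal (T_ideal v).

Let Tm_surj (u : ideal) : exists v, T v = mideal_val u.
Proof. by case: u => r hr; apply: T_surj. Qed.

Let cI (u : ideal) : 'rV[P]_k := projT1 (cid (Tm_surj u)).

Let TcI u : T (cI u) = mideal_val u. Proof. exact: projT2 (cid (Tm_surj u)). Qed.

(** The degree of [x^a y^(e a)] is [a - e a = lam a + (n - lam ord_max)]; the shift in [Iell]
    removes the constant and leaves [lam a]. *)
Let degT j v : degR j (T v) <-> hrow lam (j - (n%:Z - lam ord_max)) v.
Proof.
split=> [h|/hrowP h a b].
  apply/hrowP => a b ne; have := h a (b + e a)%N.
  rewrite /coefxy coefT coefMXn ltnNge leq_addl addnK => /(_ ne) <-.
  rewrite PoszD eE; have := ltn_ord a; lia.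
rewrite /coefxy; case: (ltnP a k) => ha; last by rewrite coef_out // coef0 eqxx.
rewrite (coefT _ (Ordinal ha)) coefMXn; case: ltnP => hb; first by rewrite eqxx.
move=> /h; have := eE (Ordinal ha); move: hb => /=.
by move: (e a) (lam _) (lam _) => x y z; lia.
Qed.

Lemma Iell_coords : coords (Iell k F l) lam (homog lam lam 1 (shift_mx F k)).
Proof.
refine (@Coords F k (Iell k F l) k lam _ cI Tm _ _ _ _ _ _).
- by move=> u v; apply: T_inj; rewrite TD !TcI.
- by move=> p u; apply: T_inj; rewrite TC !TcI.
- by move=> u; apply: T_inj; rewrite TX !TcI.
- by move=> u; apply: val_inj; rewrite /= TcI.
- by move=> v; apply: T_inj; rewrite TcI.
move=> i u; have := degT (i + (k%:Z - 1 - elt l k)) (cI u).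
rewrite TcI (_ : i + _ - _ = i) //.
by rewrite /ell /=; lia.
Qed.

End IdealCoordinates.

(** * Linear algebra at y = 1 *)

Section DualSpan.
Variables (K : fieldType) (V : vectType K) (I : finType).
Variables (Q : pred I) (v : I -> V) (w : I -> V -> K).
Hypothesis w_lin : forall i, linear (w i : V -> K^o).
Hypothesis w_dual : forall i j, w i (v j) = (i == j)%:R.

(** Applying [w i] to a vanishing combination isolates the coefficient of [v i], so the family is
    free. *)
Lemma dim_span_dual : \dim <<[seq v i | i in Q]>>%VS = #|Q|.
Proof.
rewrite -[RHS](size_image v Q); apply/eqP.
have := @freeP K V #|Q| (image_tuple v Q); rewrite /free => /rwP[fr _]; apply: fr.
move=> c c0 i; set j0 := enum_val i.
have w0 : w j0 0 = 0.
  apply: (addrI (w j0 0)); rewrite addr0.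
  by have := w_lin j0 1 0 0; rewrite !scale1r addr0 => /esym.
have wD x y : w j0 (x + y) = w j0 x + w j0 y.
  by have := w_lin j0 1 x y; rewrite !scale1r.
have wZ b x : w j0 (b *: x) = b * w j0 x.
  by have := w_lin j0 b x 0; rewrite w0 !addr0.
have := congr1 (w j0) c0; rewrite (big_morph _ wD w0) w0.
rewrite (bigD1 i) //= big1 => [|j ji];
  rewrite wZ nth_image w_dual.
  by rewrite eqxx mulr1 addr0.
by rewrite (inj_eq enum_val_inj) eq_sym (negPf ji) mulr0.
Qed.

Lemma span_imageP u : u \in <<[seq v i | i in Q]>>%VS <->
  exists c : I -> K, u = \sum_(i | Q i) c i *: v i.
Proof.
split=> [|[c ->]]; last first.
  by apply: memv_suml => i Qi; apply/memvZ/memv_span/image_f.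
move=> /(@coord_span _ _ _ (image_tuple v Q)) Eu.
exists (fun i => \sum_(j < #|Q| | enum_val j == i) coord (image_tuple v Q) j u).
rewrite {1}Eu (partition_big (fun j : 'I_#|Q| => enum_val j) Q) => [|j _]; last first.
  exact: enum_valP.
apply: eq_bigr => i Qi; rewrite scaler_suml; apply: eq_bigr => j /eqP <-.
by rewrite nth_image.
Qed.

End DualSpan.

(** * Powers and commutators of the nilpotent Jordan block *)

Section ShiftMatrix.
Variables (F : fieldType) (n : nat).
Local Notation k := n.+1.
Local Notation J := (shift_mx F k).

(** The power [J ^+ d] with explicit entries, by [shift_mxX]. *)
Definition diag_mx_at (d : nat) : 'M[F]_k := \matrix_(p, q) (q == p + d :> nat)%N%:R.

Lemma shift_mulE m (M : 'M[F]_(k, m)) (p : 'I_k) q (hp : (p.+1 < k)%N) :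
  (J *m M) p q = M (Ordinal hp) q.
Proof.
rewrite mxE (bigD1 (Ordinal hp)) //= mxE eqxx mul1r big1 ?addr0 // => j jp.
rewrite mxE (_ : (j == p.+1 :> nat) = false) ?mul0r //.
by apply: contraNF jp => /eqP E; apply/eqP/val_inj.
Qed.

Lemma shift_mul_last m (M : 'M[F]_(k, m)) (p : 'I_k) q :
  (n <= p)%N -> (J *m M) p q = 0.
Proof.
move=> hp; rewrite mxE big1 // => j _; rewrite mxE.
rewrite (_ : (j == p.+1 :> nat) = false) ?mul0r //.
by apply/negbTE; have := ltn_ord j; lia.
Qed.

Lemma mul_shiftE m (M : 'M[F]_(m, k)) p (q : 'I_k) (hq : (q.+1 < k)%N) :
  (M *m J) p (Ordinal hq) = M p q.
Proof.
rewrite mxE (bigD1 q) //= mxE /= eqxx mulr1 big1 ?addr0 // => j jq.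
rewrite mxE /= eqSS eq_sym (_ : (j == q :> nat) = false) ?mulr0 //.
by apply: contraNF jq => /eqP E; apply/eqP/val_inj.
Qed.

Lemma mul_shift0 m (M : 'M[F]_(m, k)) p : (M *m J) p 0 = 0.
Proof. by rewrite mxE big1 // => j _; rewrite mxE mulr0. Qed.

Lemma shift_diag_mx_at d : J *m diag_mx_at d = diag_mx_at d.+1.
Proof.
apply/matrixP => p q; rewrite [RHS]mxE; have := ltn_ord q; have := ltn_ord p.
have [hp _ _|hp] := ltnP p n.
  by rewrite shift_mulE // mxE /= addSnnS.
rewrite shift_mul_last // => hp' hq; case: eqP => // E; lia.
Qed.

Lemma diag_mx_at_shift d : diag_mx_at d *m J = diag_mx_at d.+1.
Proof.
apply/matrixP => p q; case: q => [[|q] hq].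
  rewrite (_ : Ordinal hq = 0); last exact: val_inj.
  by rewrite mul_shift0 mxE addnS.
have hq' : (q < k)%N by apply: ltnW.
by rewrite (@mul_shiftE _ _ p (Ordinal hq') hq) !mxE /= addnS eqSS.
Qed.

Lemma shift_mxX i : J ^+ i = diag_mx_at i.
Proof.
elim: i => [|i IH].
  apply/matrixP => p q; rewrite expr0 !mxE addn0 eq_sym.
  by rewrite -val_eqE.
by rewrite exprS IH; exact: shift_diag_mx_at.
Qed.

Lemma shift_mx_nil : J ^+ k = 0.
Proof.
rewrite shift_mxX; apply/matrixP => p q; rewrite !mxE.
case: eqP => // E; have := ltn_ord q; lia.
Qed.

Lemma shift_block_exp (N : 'M[F]_k) i :
  (block_mx J 0 N J : 'M_((n + k).+1)) ^+ i =
  block_mx (J ^+ i) 0 (\sum_(j < i) J ^+ j *m N *m J ^+ (i.-1 - j)) (J ^+ i).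
Proof.
elim: i => [|i IH].
  by rewrite big_ord0 !expr0 -scalar_mx_block.
rewrite exprSr IH; refine (etrans (mulmx_block (J ^+ i) 0 _ (J ^+ i) J 0 N J) _).
rewrite !mulmx0 !mul0mx add0r addr0.
rewrite [J ^+ i *m J](_ : _ = J ^+ i.+1) ?exprSr //.
congr block_mx; rewrite ?addr0 ?add0r // big_ord_recr /= subnn expr0 mulmx1; congr (_ + _).
rewrite mulmx_suml; apply: eq_bigr => j _; rewrite -!mulmxA; do 2 congr (_ *m _).
have -> : (i - j = (i.-1 - j).+1)%N by have := ltn_ord j; lia.
by rewrite exprSr.
Qed.

Definition diag_sum (N : 'M[F]_k) : 'rV[F]_k :=
  \row_c \sum_(pq : 'I_k * 'I_k | (pq.1 == pq.2 + c :> nat)%N) N pq.1 pq.2.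

Lemma diag_sum_linear : linear diag_sum.
Proof.
move=> a M N; apply/rowP => c; rewrite !mxE mulr_sumr -big_split.
by apply: eq_bigr => pq _; rewrite !mxE.
Qed.

Lemma diag_mx_conjE (N : 'M[F]_k) i j p q : (diag_mx_at j *m N *m diag_mx_at i) p q =
  \sum_(pq : 'I_k * 'I_k | (pq.1 == p + j :> nat)%N && (q == pq.2 + i :> nat)%N) N pq.1 pq.2.
Proof.
rewrite mxE; under eq_bigr => q' _ do rewrite !mxE mulr_suml.
rewrite exchange_big pair_big [RHS]big_mkcond; apply: eq_bigr => -[p' q'] _ /=.
by rewrite mxE; case: eqP; case: eqP; rewrite ?mul1r ?mul0r ?mulr1 ?mulr0.
Qed.

(** Term [j] moves the entry at [(p', q')] to [(p' - j, q' + n - j)], so [(p, q)] collects entries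
    with [p' - q' = n + p - q]. For each of them [j = p' - p] is forced and lies in range, so the
    whole diagonal is summed. *)
Lemma shift_norm_sumE (N : 'M[F]_k) p q :
  (\sum_(j < k) J ^+ j *m N *m J ^+ (n - j)) p q =
  \sum_(pq : 'I_k * 'I_k | (pq.1 + q == pq.2 + n + p)%N) N pq.1 pq.2.
Proof.
rewrite summxE; under eq_bigr => j _ do rewrite !shift_mxX diag_mx_conjE big_mkcond.
rewrite exchange_big [RHS]big_mkcond; apply: eq_bigr => -[p' q'] _ /=.
have := ltn_ord q; have := ltn_ord p'; have := ltn_ord q'; rewrite !ltnS => hq' hp' hq.
case: eqP => E.
  have hj : (p' - p < k)%N by lia.
  rewrite (bigD1 (Ordinal hj)) //= big1 ?addr0 => [|j jj]; last first.
    case: andP => // -[/eqP E1 _]; case/eqP: jj; apply: val_inj => /=; lia.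
  by rewrite ifT //; apply/andP; split; apply/eqP; lia.
rewrite big1 // => j _; case: andP => // -[/eqP E1 /eqP E2].
have := ltn_ord j; lia.
Qed.

Lemma shift_block_nilP (N : 'M[F]_k) :
  (block_mx J 0 N J : 'M_((n + k).+1)) ^+ k = 0 <-> diag_sum N = 0.
Proof.
rewrite shift_block_exp shift_mx_nil /=; set S := \sum_(_ < _) _.
have SE p q : S p q = \sum_(pq : 'I_k * 'I_k | (pq.1 + q == pq.2 + n + p)%N) N pq.1 pq.2.
  exact: shift_norm_sumE.
split=> [h|h].
  have S0 : S = 0.
    have := congr1 (@dlsubmx _ k k k k) h; rewrite block_mxKdl => ->.
    by apply/matrixP => i j; rewrite !mxE.
  apply/rowP => c; rewrite mxE [RHS]mxE.
  (* The last column of [S] lists all the diagonal sums. *)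
  transitivity (S c ord_max); last by rewrite S0 mxE.
  rewrite SE; apply: eq_bigl => -[p' q'] /=.
  by apply/eqP/eqP; lia.
suff -> : S = 0 by exact: (@block_mx0 F k k k k).
apply/matrixP => p q; rewrite SE mxE.
have hq := ltn_ord q; rewrite ltnS in hq.
(* Position [(p, q)] carries the diagonal with offset [n - q + p], which is empty once the offset
   exceeds [n]. *)
have [hc|hc] := ltnP (n - q + p) k; last first.
  rewrite big_pred0 // => -[p' q'] /=; apply/eqP => E; have := ltn_ord p'; lia.
have /rowP/(_ (Ordinal hc)) := h; rewrite mxE [RHS]mxE => h0.
by apply: etrans h0; apply: eq_bigl => -[p' q'] /=; apply/eqP/eqP; lia.
Qed.

(** By [shift_block_nilP] it is enough that the sum of [J^j (J h - h J) J^(n - j)] vanishes; it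
    telescopes to [J^k h - h J^k]. *)
Lemma diag_sum_comm (h : 'M[F]_k) : diag_sum (J *m h - h *m J) = 0.
Proof.
apply/shift_block_nilP; rewrite shift_block_exp shift_mx_nil /=.
suff -> : \sum_(j < k) J ^+ j *m (J *m h - h *m J) *m J ^+ (n - j) = 0 by exact: (@block_mx0 F k k k k).
pose f j := J ^+ j *m h *m J ^+ (k - j).
rewrite (eq_bigr (fun j : 'I_k => f j.+1 - f j)) => [|j _].
  rewrite -(big_mkord xpredT (fun j => f j.+1 - f j)) telescope_sumr //.
  by rewrite /f subn0 subnn shift_mx_nil mul0mx mulmx0 mul0mx subrr.
rewrite /f mulmxBr mulmxBl subSS !mulmxA; congr (_ - _).
  by rewrite [J ^+ j *m J](_ : _ = J ^+ j.+1) ?exprSr.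
rewrite -!mulmxA; do 2 congr (_ *m _).
have -> : (k - j = (n - j).+1)%N by have := ltn_ord j; lia.
by rewrite exprS.
Qed.

(** Comparing entries at [(p, q)] gives [N p.+1 q = N p q.-1] for [q > 0] and [N p.+1 0 = 0]; follow
    the diagonal up to row 0 or column 0. *)
Lemma comm_shift_toeplitz (N : 'M[F]_k) : J *m N = N *m J ->
  forall p q, N p q = if (p <= q)%N then N 0 (inord (q - p)) else 0.
Proof.
move=> NJ; case=> p hp; elim: p hp => [|p IH] hp [q hq] /=.
  rewrite subn0; congr (N _ _); apply: val_inj => //=; by rewrite inordK.
have hp' : (p < k)%N by apply: ltnW.
rewrite -(@shift_mulE _ N (Ordinal hp') (Ordinal hq) hp) NJ.
case: q hq => [|q] hq.
  by rewrite (_ : Ordinal hq = 0) ?mul_shift0 //; apply: val_inj.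
have hq' : (q < k)%N by apply: ltnW.
by rewrite (@mul_shiftE _ N _ (Ordinal hq') hq) IH.
Qed.

End ShiftMatrix.

(** * Counting *)

Section Dimensions.
Variables (F : fieldType) (n : nat).
Local Notation k := n.+1.
Local Notation J := (shift_mx F k).
Variables (a b : 'I_k -> int).
Hypothesis a_lt : forall p q : 'I_k, (p < q)%N -> a p < a q.
Hypothesis b_lt : forall p q : 'I_k, (p < q)%N -> b p < b q.

Definition supp_pairs (s : int) : pred ('I_k * 'I_k) :=
  fun pq => a pq.1 + s <= b pq.2.

Definition supp_space (s : int) : {vspace 'M[F]_k} :=
  <<[seq delta_mx pq.1 pq.2 | pq in supp_pairs s]>>%VS.

Definition nonempty_diag : pred 'I_k :=
  fun c => [exists pq : 'I_k * 'I_k, (pq.1 == pq.2 + c :> nat)%N && supp_pairs 1 pq].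

Definition full_diag : pred 'I_k :=
  fun d => [forall pq : 'I_k * 'I_k, (pq.2 == pq.1 + d :> nat)%N ==> supp_pairs 0 pq].

Let entry_linear (pq : 'I_k * 'I_k) :
  linear ((fun N => N pq.1 pq.2) : 'M[F]_k -> F^o).
Proof. by move=> x M N; rewrite !mxE. Qed.

Let entry_dual (pq pq' : 'I_k * 'I_k) :
  (delta_mx pq'.1 pq'.2 : 'M[F]_k) pq.1 pq.2 = (pq == pq')%:R.
Proof. by case: pq => p q; case: pq' => p' q'; rewrite mxE xpair_eqE. Qed.

Lemma dim_supp_space s : \dim (supp_space s) = #|supp_pairs s|.
Proof. exact: (dim_span_dual _ entry_linear entry_dual). Qed.

Lemma supp_spaceP s N : N \in supp_space s <-> hsupp a b s N.
Proof.
split=> [/span_imageP[c ->] p q|hN].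
  rewrite summxE => ne; apply: contraNT ne => npq.
  rewrite big1 // => -[p' q'] S'; rewrite mxE (entry_dual (p, q)).
  by case: eqP => [E|_]; [rewrite -E in S'; rewrite [_ <= _]S' in npq | rewrite mulr0].
apply/span_imageP; exists (fun pq => N pq.1 pq.2).
rewrite {1}[N]matrix_sum_delta pair_big [RHS]big_mkcond; apply: eq_bigr => -[p q] _ /=.
case: ifP => // /negbT npq; have [->|/hN] := eqVneq (N p q) 0; first by rewrite scale0r.
by move=> S; rewrite /supp_pairs /= S in npq.
Qed.

Definition diag_sumL : 'Hom('M[F]_k, 'rV[F]_k) := linfun (mk_linear (@diag_sum_linear F n)).

Lemma diag_sumLE N : diag_sumL N = diag_sum N.
Proof. by rewrite lfunE. Qed.

Definition cocycles : {vspace 'M[F]_k} := (supp_space 1 :&: lker diag_sumL)%VS.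

(** A delta matrix at a supported position on diagonal [c] maps to the basis vector [e c], and a
    diagonal without supported positions always sums to 0. *)
Lemma dim_diag_sums : \dim (diag_sumL @: supp_space 1) = #|nonempty_diag|.
Proof.
pose e (c : 'I_k) : 'rV[F]_k := delta_mx 0 c.
have -> : (diag_sumL @: supp_space 1)%VS = <<[seq e c | c in nonempty_diag]>>%VS.
  apply/vspaceP => v; apply/idP/idP.
    move=> /memv_imgP[N /supp_spaceP hN ->]; rewrite diag_sumLE.
    apply/span_imageP; exists (fun c => diag_sum N 0 c).
    rewrite {1}[diag_sum N]row_sum_delta [RHS]big_mkcond; apply: eq_bigr => c _.
    case: ifP => // /negbT hc; rewrite mxE big1 ?scale0r // => pq /eqP Epq.
    apply/eqP; apply: contraNT hc => /hN S; apply/existsP; exists pq.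
    by rewrite Epq eqxx.
  move=> /span_imageP[c ->]; apply: memv_suml => d /existsP[[p q] /andP[/eqP Epq Spq]].
  apply: memvZ; have -> : e d = diag_sumL (delta_mx p q).
    rewrite diag_sumLE; apply/rowP => d'; rewrite !mxE /=.
    rewrite big_mkcond (bigD1 (p, q)) //= big1 ?addr0 => [|[p' q'] ne]; last first.
      by rewrite (entry_dual (p', q') (p, q)) (negPf ne); case: ifP.
    rewrite mxE !eqxx /= [p == _ :> nat]eq_sym Epq /= eqn_add2l eq_sym val_eqE.
    by rewrite [d == _]eq_sym; case: (d' == d).
  apply: memv_img; apply/supp_spaceP => p' q'.
  rewrite (entry_dual (p', q') (p, q)); case: ((p', q') =P (p, q)) => [[-> ->] _|_]; last by rewrite eqxx.
  exact: Spq.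
apply: (@dim_span_dual _ _ _ nonempty_diag e (fun c v => v 0 c)) => [c x u v|c d].
  by rewrite !mxE.
by rewrite mxE eqxx.
Qed.

Lemma dim_cocycles : (\dim cocycles + #|nonempty_diag| = #|supp_pairs 1|)%N.
Proof. by rewrite -dim_diag_sums limg_ker_dim dim_supp_space. Qed.

Definition shift_comm (h : 'M[F]_k) : 'M[F]_k := J *m h - h *m J.

Lemma shift_comm_linear : linear shift_comm.
Proof.
move=> x u v; rewrite /shift_comm mulmxDr mulmxDl -scalemxAl -scalemxAr.
by rewrite scalerBr opprD addrACA.
Qed.

Definition shift_commL : 'End('M[F]_k) := linfun (mk_linear shift_comm_linear).

Lemma shift_commLE h : shift_commL h = shift_comm h.
Proof. by rewrite lfunE. Qed.

Definition coboundaries : {vspace 'M[F]_k} := (shift_commL @: supp_space 0)%VS.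

Lemma coboundariesP N : N \in coboundaries <->
  exists H, hsupp a b 0 H /\ N = J *m H - H *m J.
Proof.
split=> [/memv_imgP[H /supp_spaceP hH ->]|[H [hH ->]]].
  by exists H; rewrite shift_commLE.
by rewrite -[_ - _]shift_commLE; apply/memv_img/supp_spaceP.
Qed.

(** A matrix commuting with [J] is upper triangular Toeplitz, so a diagonal on which it is nonzero
    lies entirely in the support. *)
Lemma full_diag_space :
  (supp_space 0 :&: lker shift_commL)%VS =
  <<[seq diag_mx_at F n (val d) | d in full_diag]>>%VS.
Proof.
apply/vspaceP => N; apply/idP/idP.
  rewrite memv_cap => /andP[/supp_spaceP hN].
  rewrite memv_ker shift_commLE subr_eq0 => /eqP /comm_shift_toeplitz NT.
  apply/span_imageP; exists (fun d => N 0 d); apply/matrixP => p q.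
  rewrite summxE NT; case: leqP => pq; last first.
    rewrite big1 // => d _; rewrite !mxE; case: eqP => [E|_]; last by rewrite mulr0.
    by move: pq; rewrite E ltnNge leq_addr.
  have hd : (q - p < k)%N by apply: leq_ltn_trans (leq_subr _ _) (ltn_ord q).
  have Ed : inord (q - p) = Ordinal hd by apply: val_inj; rewrite /= inordK.
  rewrite Ed big_mkcond (bigD1 (Ordinal hd)) //= big1 => [|d dd]; last first.
    case: ifP => // _; rewrite !mxE; case: eqP => [E|_]; last by rewrite mulr0.
    by case/eqP: dd; apply: val_inj; rewrite /= E addKn.
  rewrite addr0; case: ifP => [_|/negbT nf]; first by rewrite !mxE /= subnKC // eqxx mulr1.
  apply/eqP; apply: contraNT nf => ne; apply/forallP => -[p' q'] /=.
  apply/implyP => /eqP E; apply: (hN p' q'); rewrite NT E leq_addr.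
  by rewrite addKn Ed.
move=> /span_imageP[c ->]; apply: memv_suml => d /forallP fd; apply: memvZ.
rewrite memv_cap memv_ker shift_commLE /shift_comm.
rewrite shift_diag_mx_at diag_mx_at_shift subrr eqxx andbT.
apply/supp_spaceP => p q; rewrite mxE; case: ((q : nat) =P (p + d)%N) => [E _|_]; last by rewrite eqxx.
by have := fd (p, q); rewrite /= E eqxx.
Qed.

Lemma dim_coboundaries : (\dim coboundaries + #|full_diag| = #|supp_pairs 0|)%N.
Proof.
have <- : \dim (supp_space 0 :&: lker shift_commL) = #|full_diag|.
  rewrite full_diag_space.
  apply: (@dim_span_dual _ _ _ full_diag _ (fun d (N : 'M[F]_k) => N 0 d)) => [d x u v|d d'].
    by rewrite !mxE.
  by rewrite mxE.
by rewrite addnC limg_ker_dim dim_supp_space.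
Qed.

(** The diagonal sums vanish by [diag_sum_comm]. For the support, [J h] and [h J] have entries
    [h p.+1 q] and [h p q.-1] at [(p, q)], and strict growth of [a] and [b] turns the weak
    inequality into a strict one. *)
Lemma coboundaries_sub : (coboundaries <= cocycles)%VS.
Proof.
apply/subvP => N /coboundariesP[h [hh ->]]; rewrite memv_cap memv_ker diag_sumLE.
rewrite diag_sum_comm eqxx andbT; apply/supp_spaceP => p q.
have [//|ne] := boolP (a p + 1 <= b q); case/eqP; rewrite !mxE.
have h1 p' q' : b q' < a p' -> h p' q' = 0.
  by move=> lt; apply/eqP; apply: contraTT lt => /hh; rewrite addr0 leNgt.
rewrite -[X in X - _]/(_) big1 => [|p' _]; last first.
  rewrite mxE; case: eqP => [E|_]; last by rewrite mul0r.
  rewrite h1 ?mulr0 //; have := @a_lt p p'; rewrite E ltnSn => /(_ isT); lia.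
rewrite sub0r big1 ?oppr0 // => q' _.
rewrite mxE; case: eqP => [E|_]; last by rewrite mulr0.
rewrite h1 ?mul0r //; have := @b_lt q' q; rewrite E ltnSn => /(_ isT); lia.
Qed.

Lemma cocyclesP N : N \in cocycles <->
  hsupp a b 1 N /\ (block_mx J 0 N J : 'M_((n + k).+1)) ^+ k = 0.
Proof.
rewrite shift_block_nilP memv_cap memv_ker diag_sumLE.
by split=> [/andP[/supp_spaceP h /eqP ->]|[/supp_spaceP -> ->]]; rewrite ?eqxx.
Qed.

(** Over the integers the two supports differ by the pairs with [a p = b q]; since [b] is injective,
    these are counted by [p]. *)
Lemma card_supp_pairs (Ea : injective a) (Eb : injective b) :
  (#|supp_pairs 0| = #|supp_pairs 1| + #|[pred p | [exists q, b q == a p]]|)%N.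
Proof.
rewrite -(cardID (supp_pairs 1) (supp_pairs 0)); congr (_ + _)%N.
  apply: eq_card => pq; rewrite !inE /in_mem /= /supp_pairs.
  by apply/andP/idP => [[]//|h]; split=> //; lia.
pose f (pq : 'I_k * 'I_k) := pq.1.
rewrite -(card_in_imset (f := f)) => [|[p q] [p' q']].
  apply: eq_card => p; rewrite inE; apply/imsetP/existsP.
    move=> [[p' q]]; rewrite !inE /in_mem /= /supp_pairs /= => h ->.
    by exists q; apply/eqP; rewrite /f /=; lia.
  move=> [q /eqP E]; exists (p, q) => //.
  by rewrite !inE /in_mem /= /supp_pairs /= E; apply/andP; split; lia.
rewrite !inE /in_mem /= /supp_pairs /= /f /= => h h' E; rewrite -{p'}E in h' *.
by congr pair; apply: Eb; lia.
Qed.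

End Dimensions.

(** The solutions form an initial segment of [1, ..., k], so the largest one equals their number.
    Substituting [p = k - d] turns the parameter of [alpha] and [beta] into the offset of a
    diagonal. *)
Lemma bigmax_initial_segment k (Q : pred nat) :
  (forall p, (0 < p < k)%N -> Q p.+1 -> Q p) ->
  (\max_(1 <= p < k.+1 | Q p) p = #|[pred d : 'I_k | Q (k - d)%N]|)%N.
Proof.
move=> Qdown.
have -> : #|[pred d : 'I_k | Q (k - d)%N]| = (\sum_(1 <= p < k.+1) Q p)%N.
  rewrite big_add1 big_mkord -sum1_card big_mkcond (reindex_inj rev_ord_inj) /=.
  apply: eq_bigr => i _; rewrite inE /=.
  by have -> : (k - (k - i.+1) = i.+1)%N by have := ltn_ord i; lia.
elim: k Qdown => [|k IH] Qdown; first by rewrite !big_geq.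
have -> : (\max_(1 <= p < k.+2 | Q p) p =
    maxn (\max_(1 <= p < k.+1 | Q p) p) (if Q k.+1 then k.+1 else 0))%N.
  by rewrite [LHS]big_mkcond big_nat_recr //= [X in _ = maxn X _]big_mkcond.
rewrite IH => [|p /andP[p0 pk]]; last by apply: Qdown; rewrite p0 ltnW.
rewrite [RHS]big_nat_recr //=.
case: (boolP (Q k.+1)) => Qk /=; last by rewrite maxn0 addn0.
have all1 p : (0 < p <= k.+1)%N -> Q p.
  move=> /andP[p0 pk]; have [m Em] : exists m, (p + m = k.+1)%N by exists (k.+1 - p)%N; lia.
  elim: m p p0 pk Em => [|m IHm] p p0 pk Em; first by rewrite addn0 in Em; rewrite Em.
  by apply: Qdown; [lia | apply: IHm; lia].
rewrite (eq_big_nat _ _ (F2 := fun=> 1%N)) => [|p /andP[p0 pk]]; last first.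
  by rewrite all1 // p0 ltnW.
rewrite sum_nat_const_nat muln1 subn1 /=; lia.
Qed.

Lemma elt_lt k (l : {fset int}) (hl : #|` l|%fset = k) i j :
  (0 < i < j)%N -> (j <= k)%N -> elt l i < elt l j.
Proof.
case: i j => [|i] [|j] //= ij jk; have ik : (i < k)%N by apply: ltn_trans jk.
exact: (@ell_lt k l hl (Ordinal ik) (Ordinal jk)).
Qed.

(** * [alpha], [beta] and the intersection as counts of diagonals and positions *)

Section Counting.
Variables (n : nat) (l m : {fset int}).
Local Notation k := n.+1.
Hypothesis hl : #|` l|%fset = k.
Hypothesis hm : #|` m|%fset = k.
Local Notation lam := (@ell k l).
Local Notation mu := (@ell k m).

Lemma alpha_full : alpha k l m = #|full_diag lam mu|.
Proof.
rewrite /alpha bigmax_initial_segment => [|p /andP[p0 pk] /asboolP h]; last first.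
  apply/asboolP => i j /and3P[hi hj /eqP E].
  (* As [p < k], the index [j] exceeds [i], so [j.-1] is still a valid index, and the element of [m]
     there is smaller. *)
  have hjp : Dplus k p.+1 i j.-1 by apply/and3P; split=> //; lia.
  by apply: le_trans (h _ _ hjp) (ltW (elt_lt hm _ _)); lia.
apply: eq_card => d; rewrite inE; apply/asboolP/forallP.
  move=> h [p q] /=; apply/implyP => /eqP E; rewrite /supp_pairs /= addr0.
  by apply: h; apply/and3P; split; have := ltn_ord p; have := ltn_ord q; have := ltn_ord d; lia.
move=> h i j /and3P[hi hj /eqP E].
have ik : (i.-1 < k)%N by lia.
have jk : (j.-1 < k)%N by lia.
have := h (Ordinal ik, Ordinal jk); rewrite /supp_pairs /= addr0 /ell /=.
rewrite !prednK; try lia; move/implyP; apply; have := ltn_ord d; lia.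
Qed.

(** The condition for [p] says that no pair on the lower diagonal with offset [k - p] has its
    element of [l] below its element of [m]. So [beta] counts the diagonals that miss the
    support. *)
Lemma beta_empty : (beta k l m + #|nonempty_diag lam mu| = k)%N.
Proof.
rewrite /beta bigmax_initial_segment => [|p /andP[p0 pk] /asboolP h]; last first.
  apply/asboolP => i j /and3P[hi hj /eqP E].
  have hip : Dminus k p.+1 i.-1 j by apply/and3P; split=> //; lia.
  by apply: le_trans (h _ _ hip) (ltW (elt_lt hl _ _)); lia.
rewrite -[RHS](card_ord k) -(cardC (nonempty_diag lam mu)) addnC; congr (_ + _)%N.
apply: eq_card => d; rewrite !inE; apply/asboolP/existsPn.
  move=> h [p q] /=; apply/negP => /andP[/eqP E]; rewrite /supp_pairs /=.
  have hpq : Dminus k (k - d) p.+1 q.+1.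
    by apply/and3P; split; have := ltn_ord p; have := ltn_ord q; have := ltn_ord d; lia.
  by have := h _ _ hpq; rewrite /ell; lia.
move=> h i j /and3P[hi hj /eqP E].
have ik : (i.-1 < k)%N by lia.
have jk : (j.-1 < k)%N by lia.
have := h (Ordinal ik, Ordinal jk); rewrite /supp_pairs /ell /=.
have Eij : (i.-1 == j.-1 + d)%N by apply/eqP; have := ltn_ord d; lia.
by rewrite Eij /= !prednK; lia.
Qed.

Lemma card_fsetI : #|` l `&` m|%fset = #|[pred p | [exists q, mu q == lam p]]|.
Proof.
have -> : #|` l `&` m|%fset = size [seq lam p | p <- enum 'I_k & lam p \in m].
  apply/perm_size/uniq_perm; first exact: fset_uniq.
    rewrite map_inj_uniq => [|p q]; last exact: (ell_inj hl).
    exact/filter_uniq/enum_uniq.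
  move=> z; rewrite inE (ell_mem hl); apply/andP/mapP.
    move=> [/existsP[p /eqP <-] pm]; exists p => //.
    by rewrite mem_filter pm mem_enum.
  move=> [p]; rewrite mem_filter => /andP[pm _] ->; split=> //.
  by apply/existsP; exists p.
rewrite size_map cardE -filter_predI /enum_mem -enumT; congr size.
apply: eq_filter => p; rewrite /= inE andbT; exact: ell_mem hm _.
Qed.

End Counting.

Local Open Scope fset_scope.

Theorem theoremC (K : realType) (k : nat) (hk : (2 <= k)%N)
    (l m : {fset int}) (hl : #|` l| = k) (hm : #|` m| = k) :
  exists d : nat,
    dim_Ext1 (Iell k K[i] l) (Iell k K[i] m) d /\
    d%:Z = (alpha k l m)%:Z + (beta k l m)%:Z - k%:Z - (#|` l `&` m|)%:Z.
Proof.
case: k hk hl hm => // n _ hl hm.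
set F : fieldType := K[i]%type.
have a_lt := @ell_lt n.+1 l hl; have b_lt := @ell_lt n.+1 m hm.
set Z := cocycles F (@ell n.+1 l) (@ell n.+1 m).
set D := coboundaries F (@ell n.+1 l) (@ell n.+1 m).
exists (\dim Z - \dim (Z :&: D))%N; split.
  apply: (dim_Ext1_cocycles (Iell_coords F hl) (Iell_coords F hm)) => // N.
    by rewrite !homogK; apply: cocyclesP.
  by rewrite !homogK; apply: coboundariesP.
(* Coboundaries are cocycles, so the intersection is [D] and the natural subtraction of dimensions
   is exact. *)
have DZ : (D <= Z)%VS by apply: coboundaries_sub.
rewrite (capv_idPr DZ).
have := dimvS DZ; have := dim_cocycles F (@ell n.+1 l) (@ell n.+1 m).
have := dim_coboundaries F (@ell n.+1 l) (@ell n.+1 m).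
have := card_supp_pairs (ell_inj hl) (ell_inj hm).
rewrite -/Z -/D (card_fsetI hl hm) (alpha_full hl hm).
have := beta_empty hl hm; lia.
Qed.
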